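(* Let $n\in\mathbb N$, $n\ge 1$. For $j=1,\dots,n$ consider the differential operators $$Z_j = X_s^2\,\partial_{x_j}-\mathrm{i}\,y_j\,(E+n)(2E+2n-1)-\mathrm{i}\,X_s\,q_j\,(2E+2n-1),$$ $$Z_{n+j} = X_s^2\,\partial_{y_j}+\mathrm{i}\,x_j\,(E+n)(2E+2n-1)-X_s\,\partial_{q_j}\,(2E+2n-1)$$ acting on $\mathrm{Pol}(\mathbb R^{2n},\mathbb C)\otimes\mathcal S(\mathbb R^n)$. Then: (1) the operators are $\mathfrak{mp}(2n,\mathbb R)$-equivariant, i.e. the $2n$-dimensional vector space spanned by $Z_1,\dots,Z_{2n}$ is stable under the commutator action $Z\mapsto [A,Z]$, $A\in\mathfrak{mp}(2n,\mathbb R)$, and transforms under it in the fundamental (defining, $2n$-dimensional) representation of $\mathfrak{mp}(2n,\mathbb R)\simeq\mathfrak{sp}(2n,\mathbb R)$; (2) they preserve the solution space of the symplectic Dirac operator, $Z_l:\mathrm{Ker}(D_s)\to\mathrm{Ker}(D_s)$ for $l=1,\dots,2n$; (3) they increase the homogeneity in the variables $x_1,\dots,x_n,y_1,\dots,y_n$ by one: $Z_l(M_h^s)\subset M_{h+1}^s$ for all $h\in\mathbb N_0$ and $l=1,\dots,2n$.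
   Context: Let $x_1,\dots,x_n,y_1,\dots,y_n$ be coordinates on $\mathbb R^{2n}$ and $q_1,\dots,q_n$ coordinates on $\mathbb R^n$; $\mathcal S(\mathbb R^n)$ is the Schwartz space in the variables $q$, $\mathrm{Pol}(\mathbb R^{2n},\mathbb C)$ the complex polynomials in $x,y$, and $\mathrm{Pol}_h$ the homogeneous ones of degree $h$. On $\mathrm{Pol}(\mathbb R^{2n},\mathbb C)\otimes\mathcal S(\mathbb R^n)$ define $$X_s=\sum_{j=1}^n(y_j\partial_{q_j}+\mathrm{i}x_jq_j),\quad D_s=\sum_{j=1}^n(\mathrm{i}q_j\partial_{y_j}-\partial_{x_j}\partial_{q_j}),\quad E=\sum_{j=1}^n(x_j\partial_{x_j}+y_j\partial_{y_j});$$ $D_s$ is the symplectic Dirac operator, and $\mathrm{Ker}(D_s)$ is its kernel in this space. Put $M_h^s=(\mathrm{Pol}_h(\mathbb R^{2n},\mathbb C)\otimes\mathcal S(\mathbb R^n))\cap\mathrm{Ker}(D_s)$. The Lie algebra $\mathfrak{mp}(2n,\mathbb R)\simeq\mathfrak{sp}(2n,\mathbb R)$ is realized (with the commutator bracket) as the span of the operators, for $j,k=1,\dots,n$, $$-x_j\partial_{x_k}+y_k\partial_{y_j}+q_k\partial_{q_j}+\tfrac12\delta_{j,k},$$ $$-x_j\partial_{y_j}-\tfrac{\mathrm{i}}{2}\partial_{q_j}^2,\qquad x_k\partial_{y_j}+x_j\partial_{y_k}+\mathrm{i}\partial_{q_j}\partial_{q_k}\ (j\ne k),$$ $$-y_j\partial_{x_j}-\tfrac{\mathrm{i}}{2}q_j^2,\qquad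 y_k\partial_{x_j}+y_j\partial_{x_k}+\mathrm{i}q_jq_k\ (j\neq k).$$ *)

(* Defs.v *)
From HB Require Import structures.
From mathcomp Require Import all_boot all_order all_algebra complex mpoly ring.
From mathcomp Require Import boolp classical_sets functions reals.
From mathcomp Require Import topology normedtype derive.

Set Implicit Arguments.
Unset Strict Implicit.
Unset Printing Implicit Defensive.

Import Order.TTheory GRing.Theory Num.Theory numFieldNormedType.Exports.

Local Open Scope ring_scope.
Local Open Scope complex_scope.
Local Open Scope classical_set_scope.

Local Notation Re := complex.Re.
Local Notation Im := complex.Im.

Section PartialDerivatives.
Variables (R : realType) (m : nat).
Implicit Types (f g : 'rV[R]_m -> R[i]) (v : 'rV[R]_m) (j : 'I_m).

(* R[i] is not a normed space over R in the library, so calculus of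
   complex-valued functions of real variables goes through Re and Im. *)
Definition cdifferentiable f v : Prop :=
  differentiable (fun w => Re (f w)) v /\ differentiable (fun w => Im (f w)) v.

Definition partial j f v : R[i] :=
  ('D_(delta_mx 0 j) (fun w => Re (f w)) v)
    +i* ('D_(delta_mx 0 j) (fun w => Im (f w)) v).

Definition partials (s : seq 'I_m) f : 'rV[R]_m -> R[i] := foldr partial f s.

Definition smooth f : Prop := forall s v, cdifferentiable (partials s f) v.

(* The seminorms range over words s of derivatives instead of multi-indices:
   for smooth f the order of differentiation is irrelevant. *)
Definition schwartz f : Prop :=
  smooth f /\
  forall (a : 'X_{1..m}) (s : seq 'I_m), exists B : R, forall v,
    `|(\prod_(j < m) v 0 j ^+ a j)%:C * partials s f v| <= B%:C.

Lemma cdifferentiable_cst (c : R[i]) v : cdifferentiable (fun=> c) v.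
Proof. by split; exact: differentiable_cst. Qed.

Lemma cdifferentiable_coord j v : cdifferentiable (fun w => (w 0 j)%:C) v.
Proof. by split; [exact: differentiable_coord | exact: differentiable_cst]. Qed.

Lemma ReD (x y : R[i]) : Re (x + y) = Re x + Re y.
Proof. by case: x; case: y. Qed.

Lemma ImD (x y : R[i]) : Im (x + y) = Im x + Im y.
Proof. by case: x; case: y. Qed.

Lemma cdifferentiableD f g v : cdifferentiable f v -> cdifferentiable g v ->
  cdifferentiable (fun w => f w + g w) v.
Proof.
move=> [fr fi] [gr gi]; split.
  rewrite (_ : (fun _ => _) = (fun w => Re (f w)) + (fun w => Re (g w))).
    exact: differentiableD.
  by apply/funext => w; rewrite ReD.
rewrite (_ : (fun _ => _) = (fun w => Im (f w)) + (fun w => Im (g w))).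
  exact: differentiableD.
by apply/funext => w; rewrite ImD.
Qed.

Lemma ReM (x y : R[i]) : Re (x * y) = Re x * Re y - Im x * Im y.
Proof. by case: x; case: y. Qed.

Lemma ImM (x y : R[i]) : Im (x * y) = Re x * Im y + Re y * Im x.
Proof. by case: x => a b; case: y => c d /=; rewrite [b * c]mulrC. Qed.

Lemma cdifferentiableM f g v : cdifferentiable f v -> cdifferentiable g v ->
  cdifferentiable (fun w => f w * g w) v.
Proof.
move=> [fr fi] [gr gi]; split.
  rewrite (_ : (fun _ => _) = (fun w => Re (f w)) * (fun w => Re (g w))
                            - (fun w => Im (f w)) * (fun w => Im (g w))).
    by apply: differentiableB; exact: differentiableM.
  by apply/funext => w; rewrite ReM.
rewrite (_ : (fun _ => _) = (fun w => Re (f w)) * (fun w => Im (g w))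
                          + (fun w => Re (g w)) * (fun w => Im (f w))).
  by apply: differentiableD; exact: differentiableM.
by apply/funext => w; rewrite ImM.
Qed.

Lemma partial_cst j (c : R[i]) : partial j (fun=> c) = (fun=> 0).
Proof. by apply/funext => v; rewrite /partial !derive_cst. Qed.

Lemma partial_coord i j :
  partial i (fun w => (w 0 j)%:C) = (fun=> (i == j)%:R).
Proof.
apply/funext => v; rewrite /partial /= derive_cst.
have h_lin : linear (fun w : 'rV[R]_m => w 0 j : R^o).
  by move=> a u w; rewrite !mxE.
pose hM := GRing.isLinear.Build _ _ _ _ _ h_lin.
pose h : {linear 'rV[R]_m -> R^o} := HB.pack (fun w : 'rV[R]_m => w 0 j) hM.
have hE : (fun w : 'rV[R]_m => w 0 j) = h by [].
have hc : continuous h by rewrite -hE; exact: coord_continuous.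
rewrite hE deriveE; last exact: linear_differentiable.
by rewrite diff_lin // -hE mxE eqxx /= eq_sym; case: (i == j).
Qed.

Lemma partialD j f g v : cdifferentiable f v -> cdifferentiable g v ->
  partial j (fun w => f w + g w) v = partial j f v + partial j g v.
Proof.
move=> [fr fi] [gr gi]; rewrite /partial.
rewrite (_ : (fun w => Re _) = (fun w => Re (f w)) + (fun w => Re (g w)));
  last by apply/funext => w; rewrite ReD.
rewrite (_ : (fun w => Im (_ + _)) = (fun w => Im (f w)) + (fun w => Im (g w)));
  last by apply/funext => w; rewrite ImD.
by rewrite !deriveD //; exact: diff_derivable.
Qed.

Lemma partialM j f g v : cdifferentiable f v -> cdifferentiable g v ->
  partial j (fun w => f w * g w) v = partial j f v * g v + f v * partial j g v.
Proof.
move=> [fr fi] [gr gi]; rewrite /partial.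
rewrite (_ : (fun w => Re (_ * _)) = (fun w => Re (f w)) * (fun w => Re (g w))
                            - (fun w => Im (f w)) * (fun w => Im (g w)));
  last by apply/funext => w; rewrite ReM.
rewrite (_ : (fun w => Im (_ * _)) = (fun w => Re (f w)) * (fun w => Im (g w))
                          + (fun w => Re (g w)) * (fun w => Im (f w)));
  last by apply/funext => w; rewrite ImM.
have [Hfr Hfi] := (@diff_derivable _ _ _ _ _ (delta_mx 0 j) fr,
                   @diff_derivable _ _ _ _ _ (delta_mx 0 j) fi).
have [Hgr Hgi] := (@diff_derivable _ _ _ _ _ (delta_mx 0 j) gr,
                   @diff_derivable _ _ _ _ _ (delta_mx 0 j) gi).
rewrite (deriveB (derivableM Hfr Hgr) (derivableM Hfi Hgi)).
rewrite (deriveD (derivableM Hfr Hgi) (derivableM Hgr Hfi)).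
rewrite (deriveM Hfr Hgr) (deriveM Hfi Hgi) (deriveM Hfr Hgi) (deriveM Hgr Hfi).
rewrite /GRing.scale /=.
move: ('D_ _ _ v) ('D_ _ _ v) ('D_ _ _ v) ('D_ _ _ v) => d1 d2 d3 d4.
case: (f v) => a b; case: (g v) => c d.
by apply/eqP; rewrite eq_complex /=; apply/andP; split; apply/eqP; ring.
Qed.

Lemma partials_linear s f g (c : R[i]) : smooth f -> smooth g ->
  partials s (fun w => c * f w + g w)
  = (fun w => c * partials s f w + partials s g w).
Proof.
move=> sf sg; elim: s => // j s IH; rewrite [LHS]/= -/(partials _ _) IH.
apply/funext => v; have cM := cdifferentiableM (cdifferentiable_cst c v) (sf s v).
rewrite partialD //; congr (_ + _).
rewrite (partialM _ (cdifferentiable_cst c v) (sf s v)).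
by rewrite partial_cst mul0r add0r.
Qed.

Lemma partials_cat s t f : partials (s ++ t) f = partials s (partials t f).
Proof. exact: foldr_cat. Qed.

Lemma smooth_partial j f : smooth f -> smooth (partial j f).
Proof.
by move=> sf s v; have := sf (rcons s j) v; rewrite -cats1 partials_cat.
Qed.

Lemma schwartz_partial j f : schwartz f -> schwartz (partial j f).
Proof.
move=> [sf bf]; split=> [|a s]; first exact: smooth_partial.
by have := bf a (rcons s j); rewrite -cats1 partials_cat.
Qed.

Lemma schwartz_linear f g (c : R[i]) : schwartz f -> schwartz g ->
  schwartz (fun w => c * f w + g w).
Proof.
move=> [sf bf] [sg bg]; split=> [s v|a s].
  rewrite partials_linear //; apply: cdifferentiableD => //.
  by apply: cdifferentiableM => //; exact: cdifferentiable_cst.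
have [B1 h1] := bf a s; have [B2 h2] := bg a s.
have [r cr] : exists r : R, `|c| = r%:C.
  by case: c => x y; rewrite normc_def; eexists.
exists (r * B1 + B2) => v; rewrite partials_linear // mulrDr.
apply: (le_trans (ler_normD _ _)); rewrite rmorphD; apply: lerD => //.
rewrite mulrCA normrM cr rmorphM; apply: ler_wpM2l => //.
by rewrite -cr normr_ge0.
Qed.

(* Leibniz rule for a coordinate: each remaining term of
   partials s (v_j f) is some iterated partial derivative of f. *)
Lemma partials_coordM s j f : smooth f -> exists L : seq (seq 'I_m),
  partials s (fun w => (w 0 j)%:C * f w)
  = (fun w => (w 0 j)%:C * partials s f w + \sum_(t <- L) partials t f w).
Proof.
move=> sf; elim: s => [|i s [L IH]].
  by exists [::]; apply/funext => w; rewrite big_nil addr0.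
exists ((if i == j then [:: s] else [::]) ++ [seq i :: t | t <- L]).
rewrite [LHS]/= -/(partials _ _) IH; apply/funext => v.
have cS (M : seq (seq 'I_m)) : cdifferentiable (fun w => \sum_(t <- M) partials t f w) v
    /\ partial i (fun w => \sum_(t <- M) partials t f w) v
       = \sum_(t <- M) partials (i :: t) f v.
  elim: M => [|t M [c1 c2]].
    rewrite (_ : (fun w => _) = fun=> 0); last first.
      by apply/funext => w; rewrite big_nil.
    by rewrite partial_cst big_nil; split=> //; exact: cdifferentiable_cst.
  rewrite (_ : (fun w => _) =
     fun w => partials t f w + \sum_(t <- M) partials t f w); last first.
    by apply/funext => w; rewrite big_cons.
  split; first exact: cdifferentiableD.
  by rewrite partialD // big_cons c2.
have [c1 c2] := cS L.
have cc := cdifferentiable_coord j v.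
rewrite partialD //; last exact: cdifferentiableM.
rewrite partialM // partial_coord c2 big_cat big_map /=.
rewrite -addrA addrCA; congr (_ + (_ + _)).
by case: eqP => _; rewrite ?big_seq1 ?big_nil ?mul1r ?mul0r.
Qed.

Lemma schwartz_coordM j f : schwartz f -> schwartz (fun w => (w 0 j)%:C * f w).
Proof.
move=> [sf bf]; split=> [s v|a s].
  have [L ->] := partials_coordM s j sf.
  apply: cdifferentiableD.
    by apply: cdifferentiableM => //; exact: cdifferentiable_coord.
  elim: L => [|t L IH].
    rewrite (_ : (fun w => _) = fun=> 0); first exact: cdifferentiable_cst.
    by apply/funext => w; rewrite big_nil.
  rewrite (_ : (fun w => _) =
     fun w => partials t f w + \sum_(t <- L) partials t f w).
    exact: cdifferentiableD.
  by apply/funext => w; rewrite big_cons.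
have [L ->] := partials_coordM s j sf.
have [B1 h1] := bf (a + U_(j))%MM s.
have [B2 h2] : exists B2 : R, forall v,
  `|(\prod_(k < m) v 0 k ^+ a k)%:C * \sum_(t <- L) partials t f v| <= B2%:C.
  elim: L => [|t L [B2 h2]].
    by exists 0 => v; rewrite big_nil mulr0 normr0.
  have [B3 h3] := bf a t; exists (B3 + B2) => v; rewrite big_cons mulrDr.
  by apply: (le_trans (ler_normD _ _)); rewrite rmorphD lerD.
exists (B1 + B2) => v; rewrite mulrDr.
apply: (le_trans (ler_normD _ _)); rewrite rmorphD lerD //.
have := h1 v; congr (`|_| <= _); rewrite mulrA -rmorphM; congr (_%:C * _).
under eq_bigr do rewrite mnmDE exprD.
rewrite big_split /=; congr (_ * _).
rewrite (bigD1 j) //= mnm1E eqxx expr1 big1 ?mulr1 // => k kj.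
by rewrite mnm1E eq_sym (negbTE kj) expr0.
Qed.

Definition mpfun (p : {mpoly R[i][m]}) v : R[i] := p.@[fun i => (v 0 i)%:C].

Lemma mpfun_partial (p : {mpoly R[i][m]}) j :
  (forall v, cdifferentiable (mpfun p) v) /\
  partial j (mpfun p) = mpfun (mderiv j p).
Proof.
pose P p := (forall v, cdifferentiable (mpfun p) v) /\
  partial j (mpfun p) = mpfun (mderiv j p).
have PD q r : P q -> P r -> P (q + r).
  move=> [cq d_q] [cr dr].
  have E : mpfun (q + r) = fun v => mpfun q v + mpfun r v.
    by apply/funext => v; rewrite /mpfun mevalD.
  rewrite /P E; split=> [v|]; first exact: cdifferentiableD.
  by apply/funext => v; rewrite partialD // d_q dr /mpfun mderivD mevalD.
have PM q r : P q -> P r -> P (q * r).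
  move=> [cq d_q] [cr dr].
  have E : mpfun (q * r) = fun v => mpfun q v * mpfun r v.
    by apply/funext => v; rewrite /mpfun mevalM.
  rewrite /P E; split=> [v|]; first exact: cdifferentiableM.
  by apply/funext => v; rewrite partialM // d_q dr /mpfun mderivM mevalD !mevalM.
have PC c : P c%:MP.
  have E : mpfun c%:MP = fun=> c by apply/funext => v; rewrite /mpfun mevalC.
  rewrite /P E; split=> [v|]; first exact: cdifferentiable_cst.
  by apply/funext => v; rewrite partial_cst /mpfun mderivC meval0.
have PX i : P 'X_i.
  have E : mpfun 'X_i = fun v => (v 0 i)%:C.
    by apply/funext => v; rewrite /mpfun mevalXU.
  rewrite /P E; split=> [v|]; first exact: cdifferentiable_coord.
  apply/funext => v; rewrite partial_coord /mpfun mderivX mnm1E mevalZ eq_sym.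
  case: eqP => [->|_]; last by rewrite mul0r.
  rewrite (_ : (_ - _)%MM = 0%MM) ?mpolyX0 ?meval1 ?mulr1 ?mul1r ?eqxx //.
  by apply/mnmP => k; rewrite mnmBE subnn mnm0E.
rewrite -/(P p) [p]mpolyE; apply: (big_ind P); [exact: (PC 0) | exact: PD |].
move=> mm _; rewrite -mul_mpolyC; apply: (PM) => //.
rewrite mpolyXE_id; apply: (big_ind P); [exact: (PC 1) | exact: PM |].
move=> i _; elim: (mm i) => [|k IH]; first exact: (PC 1).
by rewrite exprS; exact: PM.
Qed.

End PartialDerivatives.

Section PolynomialSchwartz.
Variables (R : realType) (n : nat).
Implicit Types (F G : 'rV[R]_(n + n) -> 'rV[R]_n -> R[i]).
Implicit Types (z : 'rV[R]_(n + n)) (q : 'rV[R]_n).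

(* W (x) S(R^n), for a set W of polynomials in the 2n variables z = (x, y), is
   realized as the space of finite sums of functions (z, q) |-> p(z) f(q). *)
Definition tensor_schwartz (W : set {mpoly R[i][n + n]}) F : Prop :=
  exists (k : nat) (p : 'I_k -> {mpoly R[i][n + n]}) (f : 'I_k -> 'rV[R]_n -> R[i]),
    (forall i, W (p i) /\ schwartz (f i)) /\
    F = (fun z q => \sum_(i < k) mpfun (p i) z * f i q).

Definition polS_pred : {pred 'rV[R]_(n + n) -> 'rV[R]_n -> R[i]} :=
  [pred F | `[< tensor_schwartz setT F >]].

Record polS := PolS { polS_fun :> 'rV[R]_(n + n) -> 'rV[R]_n -> R[i];
                      _ : polS_fun \in polS_pred }.

HB.instance Definition _ := [isSub for polS_fun].
HB.instance Definition _ := [Choice of polS by <:].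

Lemma tensor_schwartz0 W : tensor_schwartz W (fun _ _ => 0).
Proof.
exists 0%N, (fun=> 0), (fun _ _ => 0); split; first by case.
by apply/funext => z; apply/funext => q; rewrite big_ord0.
Qed.

Lemma tensor_schwartzD W F G : tensor_schwartz W F -> tensor_schwartz W G ->
  tensor_schwartz W (fun z q => F z q + G z q).
Proof.
move=> [k [p [f [pf ->]]]] [l [r [g [rg ->]]]].
exists (k + l)%N, (fun i => match @fintype.split k l i with inl i => p i | inr i => r i end),
  (fun i => match @fintype.split k l i with inl i => f i | inr i => g i end).
split=> [i|]; first by case: (@fintype.split k l i).
apply/funext => z; apply/funext => q; rewrite big_split_ord /=.
congr (_ + _); apply: eq_bigr => i _.
  by rewrite (unsplitK (inl i : 'I_k + 'I_l)).
by rewrite (unsplitK (inr i : 'I_k + 'I_l)).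
Qed.

Lemma tensor_schwartz_map (W W' : set {mpoly R[i][n + n]}) F
    (P : {mpoly R[i][n + n]} -> {mpoly R[i][n + n]})
    (S : ('rV[R]_n -> R[i]) -> 'rV[R]_n -> R[i])
    (T : ('rV[R]_(n + n) -> 'rV[R]_n -> R[i]) ->
         'rV[R]_(n + n) -> 'rV[R]_n -> R[i]) :
  (forall p, W p -> W' (P p)) -> (forall f, schwartz f -> schwartz (S f)) ->
  (forall k p f, (forall i : 'I_k, schwartz (f i)) ->
     T (fun z q => \sum_(i < k) mpfun (p i) z * f i q)
     = (fun z q => \sum_(i < k) mpfun (P (p i)) z * S (f i) q)) ->
  tensor_schwartz W F -> tensor_schwartz W' (T F).
Proof.
move=> hP hS hT [k [p [f [pf ->]]]].
exists k, (fun i => P (p i)), (fun i => S (f i)); split=> [i|].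
  by have [? ?] := pf i; split; [exact: hP | exact: hS].
by apply: hT => i; have [] := pf i.
Qed.

Lemma polS_submod_closed : submod_closed polS_pred.
Proof.
split; first exact/asboolP/tensor_schwartz0.
move=> c F G /asboolP tF /asboolP tG; apply/asboolP.
apply: (@tensor_schwartzD setT (fun z q => c * F z q)) => //.
apply: (@tensor_schwartz_map setT setT F ( *:%R c) id
  (fun F z q => c * F z q)) tF => // k p f _.
apply/funext => z; apply/funext => q; rewrite mulr_sumr; apply: eq_bigr => i _.
by rewrite /mpfun mevalZ mulrA.
Qed.

HB.instance Definition _ := GRing.isSubmodClosed.Build _ _ polS_pred
  polS_submod_closed.
HB.instance Definition _ := [SubChoice_isSubLmodule of polS by <:].

Lemma cdifferentiable_sum m k (f : 'I_k -> 'rV[R]_m -> R[i]) v :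
  (forall i, cdifferentiable (f i) v) ->
  cdifferentiable (fun w => \sum_(i < k) f i w) v.
Proof.
elim: k f => [|k IH] f cf.
  rewrite (_ : (fun w => _) = fun=> 0); first exact: cdifferentiable_cst.
  by apply/funext => w; rewrite big_ord0.
rewrite (_ : (fun w => _) =
   fun w => \sum_(i < k) f (widen_ord (leqnSn k) i) w + f ord_max w).
  by apply: cdifferentiableD => //; exact: IH.
by apply/funext => w; rewrite big_ord_recr.
Qed.

Lemma partial_sum m j k (f : 'I_k -> 'rV[R]_m -> R[i]) v :
  (forall i, cdifferentiable (f i) v) ->
  partial j (fun w => \sum_(i < k) f i w) v = \sum_(i < k) partial j (f i) v.
Proof.
elim: k f => [|k IH] f cf.
  rewrite (_ : (fun w => _) = fun=> 0) ?partial_cst ?big_ord0 //.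
  by apply/funext => w; rewrite big_ord0.
rewrite (_ : (fun w => _) =
   fun w => \sum_(i < k) f (widen_ord (leqnSn k) i) w + f ord_max w).
  rewrite partialD ?big_ord_recr ?IH //.
  exact: cdifferentiable_sum.
by apply/funext => w; rewrite big_ord_recr.
Qed.

Definition mulz_fun (i : 'I_(n + n)) F z q : R[i] := (z 0 i)%:C * F z q.
Definition dz_fun (i : 'I_(n + n)) F z q : R[i] := partial i (F^~ q) z.
Definition mulq_fun (j : 'I_n) F z q : R[i] := (q 0 j)%:C * F z q.
Definition dq_fun (j : 'I_n) F z q : R[i] := partial j (F z) q.

Lemma polSP (F : polS) : tensor_schwartz setT F.
Proof. by case: F => F /= /asboolP. Qed.

Lemma mulz_subproof i (F : polS) : mulz_fun i F \in polS_pred.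
Proof.
apply/asboolP; apply: (@tensor_schwartz_map setT setT F ( *%R 'X_i) id) (polSP F)
  => // k p f _.
apply/funext => z; apply/funext => q; rewrite /mulz_fun mulr_sumr.
by apply: eq_bigr => l _; rewrite /mpfun mevalM mevalXU mulrA.
Qed.

Lemma dz_subproof i (F : polS) : dz_fun i F \in polS_pred.
Proof.
apply/asboolP; apply: (@tensor_schwartz_map setT setT F (mderiv i) id) (polSP F)
  => // k p f _.
apply/funext => z; apply/funext => q; rewrite /dz_fun.
have c l w := (mpfun_partial (p l) i).1 w.
have cf l (w : 'rV[R]_(n + n)) := cdifferentiable_cst (f l q) w.
rewrite (partial_sum _ (fun l => cdifferentiableM (c l z) (cf l z))).
apply: eq_bigr => l _; rewrite (partialM _ (c l z) (cf l z)) partial_cst mulr0 addr0.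
by rewrite (mpfun_partial (p l) i).2.
Qed.

Lemma mulq_subproof j (F : polS) : mulq_fun j F \in polS_pred.
Proof.
apply/asboolP; apply: (@tensor_schwartz_map setT setT F id
  (fun f q => (q 0 j)%:C * f q)) (polSP F) => // [f|k p f _].
  exact: schwartz_coordM.
apply/funext => z; apply/funext => q; rewrite /mulq_fun mulr_sumr.
by apply: eq_bigr => l _; rewrite mulrCA.
Qed.

Lemma dq_subproof j (F : polS) : dq_fun j F \in polS_pred.
Proof.
apply/asboolP; apply: (@tensor_schwartz_map setT setT F id (partial j)) (polSP F)
  => // [f|k p f sf].
  exact: schwartz_partial.
apply/funext => z; apply/funext => q; rewrite /dq_fun.
have cp l := cdifferentiable_cst (mpfun (p l) z) q.
have cf l : cdifferentiable (f l) q by have [s _] := sf l; exact: (s [::]).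
rewrite (partial_sum _ (fun l => cdifferentiableM (cp l) (cf l))).
apply: eq_bigr => l _.
by rewrite (partialM _ (cp l) (cf l)) partial_cst mul0r add0r.
Qed.

Definition mul_z i (F : polS) : polS := PolS (mulz_subproof i F).
Definition d_z i (F : polS) : polS := PolS (dz_subproof i F).
Definition mul_q j (F : polS) : polS := PolS (mulq_subproof j F).
Definition d_q j (F : polS) : polS := PolS (dq_subproof j F).

End PolynomialSchwartz.

Section Operators.
Variables (R : realType) (n : nat).
Local Notation op := (polS R n -> polS R n).
(* Composition, at the level of a product: \o has the precedence of +. *)
Local Notation "A ** B" := (A \o B) (at level 40, left associativity).
Local Notation I := (idfun : op).

Definition mul_x (j : 'I_n) : op := mul_z (lshift n j).
Definition mul_y (j : 'I_n) : op := mul_z (rshift n j).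
Definition d_x (j : 'I_n) : op := d_z (lshift n j).
Definition d_y (j : 'I_n) : op := d_z (rshift n j).

Definition Xs : op :=
  \sum_(j < n) (mul_y j ** d_q j + 'i%C *: (mul_x j ** mul_q j)).

Definition Ds : op :=
  \sum_(j < n) ('i%C *: (mul_q j ** d_y j) - d_x j ** d_q j).

Definition Euler : op := \sum_(j < n) (mul_x j ** d_x j + mul_y j ** d_y j).

Definition EN : op := Euler + n%:R *: I.
Definition E2N1 : op := 2%:R *: Euler + (2%:R * n%:R - 1) *: I.

Definition Zx (j : 'I_n) : op :=
  Xs ** Xs ** d_x j - 'i%C *: (mul_y j ** EN ** E2N1)
    - 'i%C *: (Xs ** mul_q j ** E2N1).

Definition Zy (j : 'I_n) : op :=
  Xs ** Xs ** d_y j + 'i%C *: (mul_x j ** EN ** E2N1)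
    - Xs ** d_q j ** E2N1.

Definition Zop (l : 'I_(n + n)) : op :=
  match fintype.split l with inl j => Zx j | inr j => Zy j end.

Definition spanZ : set op :=
  [set W | exists c : 'I_(n + n) -> R[i], W = \sum_l c l *: Zop l].

Definition comm (A B : op) : op := A ** B - B ** A.

Definition KerDs : set (polS R n) := [set F | Ds F = 0].

Definition Ms (h : nat) : set (polS R n) :=
  [set F : polS R n | tensor_schwartz [set p | p \is h.-homog] F] `&` KerDs.

Definition mpA (j k : 'I_n) : op :=
  - (mul_x j ** d_x k) + mul_y k ** d_y j + mul_q k ** d_q j
    + (2%:R^-1 * (j == k)%:R) *: I.
Definition mpB (j : 'I_n) : op :=
  - (mul_x j ** d_y j) - ('i%C / 2%:R) *: (d_q j ** d_q j).
Definition mpB2 (j k : 'I_n) : op :=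
  mul_x k ** d_y j + mul_x j ** d_y k + 'i%C *: (d_q j ** d_q k).
Definition mpC (j : 'I_n) : op :=
  - (mul_y j ** d_x j) - ('i%C / 2%:R) *: (mul_q j ** mul_q j).
Definition mpC2 (j k : 'I_n) : op :=
  mul_y k ** d_x j + mul_y j ** d_x k + 'i%C *: (mul_q j ** mul_q k).

Inductive mp_generator : op -> Prop :=
| MpA j k : mp_generator (mpA j k)
| MpB j : mp_generator (mpB j)
| MpB2 j k of j != k : mp_generator (mpB2 j k)
| MpC j : mp_generator (mpC j)
| MpC2 j k of j != k : mp_generator (mpC2 j k).

(* mp(2n, R) is a real Lie algebra: only real coefficients are allowed. *)
Definition mp : set op :=
  [set A | exists (k : nat) (a : 'I_k -> R) (G : 'I_k -> op),
     (forall i, mp_generator (G i)) /\ A = \sum_(i < k) (a i)%:C *: G i].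

Definition sympJ : 'M[R]_(n + n) := block_mx 0 1%:M (- 1%:M) 0.

Definition sp : set 'M[R]_(n + n) :=
  [set M | M^T *m sympJ + sympJ *m M = 0].

Definition sp_mp_isomorphism (rho : 'M[R]_(n + n) -> op) : Prop :=
  [/\ set_bij sp mp rho,
      forall (a : R) M N, sp M -> sp N ->
        rho (a *: M + N) = a%:C *: rho M + rho N
    & forall M N, sp M -> sp N ->
        rho (M *m N - N *m M) = comm (rho M) (rho N)].

(* The C-linear map C^2n -> spanZ, e_l |-> Zop l, intertwines the defining action
   of sp(2n, R) on C^2n with the commutator action of mp(2n, R). *)
Definition Z_defining_rep (rho : 'M[R]_(n + n) -> op) : Prop :=
  forall M, sp M -> forall l, comm (rho M) (Zop l) = \sum_k (M k l)%:C *: Zop k.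

End Operators.

(* Main.v *)
(* Put W = (-i y, i x), D = (d_x, d_y) and U = (-i q, -d_q), three families
   indexed by 2n.  With J the standard symplectic form, the only nontrivial
   commutators are [D_a, W_b] = i J_ab and [U_a, U_b] = -i J_ab, and
     X_s = -i sum J_ab W_a U_b,  D_s = sum J_ab D_a U_b,  E = i sum J_ab W_a D_b,
     Z_a = X_s^2 D_a + W_a (E+n)(2E+2n-1) + X_s U_a (2E+2n-1).
   For M in sp(2n), S = i M J is symmetric and
     rho(M) = sum S_ab (W_a D_b - U_a U_b / 2)
   acts by commutators on W, D and U through M; the contractions with J are
   therefore invariant and Z transforms through M as well.  From
   [D_s, W] = i U, [D_s, U] = i D, [D_s, D] = 0 and [D_s, X_s] = -i (E+n) one
   gets D_s Z_a = Q D_s for some operator Q.  Evaluating Z_a on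
   1 (x) exp(-|q|^2) at q = 0 gives linear forms in (x, y) which are linearly
   independent, so that the Z_a are independent and rho is injective. *)
From HB Require Import structures.
Require Import Defs.
From mathcomp Require Import all_boot all_order all_algebra complex mpoly ring lra ssrAC.
From mathcomp Require Import boolp classical_sets functions reals.
From mathcomp Require Import topology normedtype derive realfun sequences exp.
Set Implicit Arguments.
Unset Strict Implicit.
Unset Printing Implicit Defensive.
Import Order.TTheory GRing.Theory Num.Theory numFieldNormedType.Exports.
Local Open Scope ring_scope.
Local Open Scope complex_scope.
Local Open Scope classical_set_scope.
Local Notation Re := complex.Re.
Local Notation Im := complex.Im.

(** The scalar factors of Z come from a telescoping. Put H = E + n and K = 2H - 1 = 2E + 2n - 1.
    Moving D_s to the right through X_s^2 D_a leaves - i X_s D_a K. In X_s U_a K the bracket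
    [D_s, U_a] cancels this, while [D_s, X_s] leaves - i U_a H K, which the bracket [D_s, W_a] in
    W_a H K cancels in turn. Arbitrary self-maps of the function space do not form a ring: composing
    with a non-linear map on the left need not distribute over sums. The operators are therefore
    lifted to the algebra [lop] of linear maps. The symplectic part is carried out in an abstract
    algebra satisfying the canonical relations, and these relations are checked on pure tensors.
    There the polynomial factor is formal, but the other factor is an arbitrary Schwartz function,
    so that [d_q_j, d_q_k] = 0 rests on the symmetry of second derivatives. *)

(** * Symmetry of second partial derivatives *)

(** Both equations expand the same second difference p - q - r + s, so A = B after cancelling t^2.
    In the application A and B are the mixed derivatives at intermediate points, a and b those at
    the limit point. *)
Lemma near_difference_quotients (R : realType) (p q r s A B a b e t : R) :
  t != 0 -> (p - q) - (r - s) = A * t * t -> (p - r) - (q - s) = B * t * t ->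
  `|a - A| < e / 2 -> `|b - B| < e / 2 -> `|a - b| <= e.
Proof.
move=> tn EA EB ha hb.
have AB : A = B by apply: (mulIf tn); apply: (mulIf tn); rewrite -EA -EB; ring.
rewrite (_ : a - b = (a - A) - (b - B)); last by rewrite AB; ring.
by apply: (le_trans (ler_normB _ _)); rewrite [e]splitr lerD // ltW.
Qed.

Section Clairaut.
Variables (R : realType) (V : normedModType R).
Implicit Types (f : V -> R) (u v w x : V).

Lemma is_derive_line f x u (s : R) : derivable f (x + s *: u) u ->
  is_derive s (1 : R) (fun r : R => f (x + r *: u)) ('D_u f (x + s *: u)).
Proof.
move=> df.
have E : (fun h : R => h^-1 *: (((fun r : R => f (x + r *: u)) \o shift s) (h *: (1 : R))
    - f (x + s *: u))) =
  (fun h : R => h^-1 *: ((f \o shift (x + s *: u)) (h *: u) - f (x + s *: u))).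
  apply/funext => h /=; congr (_ *: (f _ - _)).
  by rewrite [h *: 1]mulr1 scalerDl addrCA.
split; first by rewrite /derivable E.
by rewrite /derive E.
Qed.

Lemma mvt_direction f x u (t : R) : 0 < t -> (forall w, derivable f w u) ->
  exists2 s, 0 < s < t & f (x + t *: u) - f x = 'D_u f (x + s *: u) * t.
Proof.
move=> t0 df.
have dl (s : R) := is_derive_line (df (x + s *: u)).
have cl : {within `[0, t], continuous (fun r : R => f (x + r *: u))}.
  apply: continuous_subspaceT => s.
  apply: differentiable_continuous.
  by apply/derivable1_diffP; have [] := dl s.
have [s] := MVT t0 (fun s _ => dl s) cl.
by rewrite in_itv /= => st; rewrite scale0r addr0 subr0 => ->; exists s.
Qed.

(** The mean value theorem is used twice: along u for w |-> f (w + t v) - f w, then along v for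
    ['D_u f]. The second difference on the left is symmetric in u and v, so exchanging them
    expresses the same number by the other mixed derivative. *)
Lemma double_difference f u v x (t : R) : 0 < t ->
  (forall w, derivable f w u) -> (forall w, derivable ('D_u f) w v) ->
  exists s r, [/\ 0 < s < t, 0 < r < t &
    (f (x + t *: v + t *: u) - f (x + t *: u)) - (f (x + t *: v) - f x)
    = 'D_v ('D_u f) (x + s *: u + r *: v) * t * t].
Proof.
move=> t0 du dv.
pose g w := f (w + t *: v) - f w.
have dsh w : is_derive w u (fun w => f (w + t *: v)) ('D_u f (w + t *: v)).
  have E : (fun h : R => h^-1 *: (((fun w => f (w + t *: v)) \o shift w) (h *: u)
       - f (w + t *: v))) =
    (fun h : R => h^-1 *: ((f \o shift (w + t *: v)) (h *: u) - f (w + t *: v))).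
    by apply/funext => h /=; rewrite addrA.
  by split; [rewrite /derivable E; exact: du | rewrite /derive E].
have dg w : is_derive w u g ('D_u f (w + t *: v) - 'D_u f w).
  exact: is_deriveB (dsh w) (derivableP (du w)).
have [s st Es] := @mvt_direction g x u t t0 (fun w => @ex_derive _ _ _ _ _ _ _ (dg w)).
have [r rt Er] := mvt_direction (x + s *: u) t0 dv.
exists s, r; split=> //; rewrite -Er.
have dE : 'D_u g (x + s *: u) = _ := @derive_val _ _ _ _ _ _ _ (dg _).
by rewrite -dE -Es /g [x + t *: v + _]addrAC.
Qed.

Lemma derive_comm f u v x :
  (forall w, derivable f w u) -> (forall w, derivable f w v) ->
  (forall w, derivable ('D_u f) w v) -> (forall w, derivable ('D_v f) w u) ->
  {for x, continuous ('D_v ('D_u f))} -> {for x, continuous ('D_u ('D_v f))} ->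
  'D_v ('D_u f) x = 'D_u ('D_v f) x.
Proof.
move=> du dv duv dvu c1 c2.
apply/eqP; rewrite -subr_eq0; apply/eqP/normr0_eq0/eqP.
rewrite eq_le normr_ge0 andbT; apply/ler_addgt0Pr => e e0; rewrite add0r.
have e20 : 0 < e / 2 by rewrite divr_gt0.
have /cvgrPdist_lt/(_ _ e20)/nbhs_ballP[d1 /= d10 h1] := c1.
have /cvgrPdist_lt/(_ _ e20)/nbhs_ballP[d2 /= d20 h2] := c2.
pose d := Num.min d1 d2.
have d0 : 0 < d by rewrite lt_min d10.
(* With this t the whole parallelogram spanned by t u and t v at x lies in the ball of radius d; the
   summand 1 keeps the denominator positive when u = v = 0. *)
pose t := d / (`|u| + `|v| + 1).
have N0 : 0 < `|u| + `|v| + 1 by rewrite ltr_pwDr // addr_ge0.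
have t0 : 0 < t by rewrite divr_gt0.
have inb s r : 0 < s < t -> 0 < r < t -> ball x d (x + s *: u + r *: v).
  move=> /andP[s0 st] /andP[r0 rt].
  rewrite -ball_normE /ball_ /= -addrA opprD addNKr normrN.
  apply: (le_lt_trans (ler_normD _ _)); rewrite !normrZ !gtr0_norm //.
  rewrite -(divfK (lt0r_neq0 N0) d) -/t !mulrDr mulr1 ltr_pwDr //.
  by apply: lerD; apply: ler_wpM2r => //; exact: ltW.
have [s [r [hs hr E]]] := double_difference x t0 du duv.
have [s' [r' [hs' hr' E']]] := double_difference x t0 dv dvu.
have b1 : ball x d1 (x + s *: u + r *: v).
  by apply: le_ball (inb _ _ hs hr); rewrite ge_min lexx.
have b2 : ball x d2 (x + s' *: v + r' *: u).
  rewrite addrAC; apply: le_ball (inb _ _ hr' hs').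
  by rewrite ge_min lexx orbT.
move: (h1 _ b1) (h2 _ b2) => {b1 b2} {}h1 {}h2.
rewrite [x + _ *: v + _]addrAC in E.
exact: (near_difference_quotients (lt0r_neq0 t0) E E' h1 h2).
Qed.

End Clairaut.

(** Smoothness makes the second partials differentiable, hence continuous, which is what
    [derive_comm] asks for; real and imaginary parts are treated separately. *)
Lemma partialC (R : realType) (m : nat) (f : 'rV[R]_m -> R[i]) i j :
  smooth f -> partial i (partial j f) = partial j (partial i f).
Proof.
move=> sf; apply/funext => w.
have d1 z := sf [::] z.
have dR k z : differentiable ('D_(delta_mx 0 k) (fun w => Re (f w))) z :=
  (sf [:: k] z).1.
have dI k z : differentiable ('D_(delta_mx 0 k) (fun w => Im (f w))) z :=
  (sf [:: k] z).2.
have ddR k l : differentiable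
    ('D_(delta_mx 0 k) ('D_(delta_mx 0 l) (fun w => Re (f w)))) w :=
  (sf [:: k; l] w).1.
have ddI k l : differentiable
    ('D_(delta_mx 0 k) ('D_(delta_mx 0 l) (fun w => Im (f w)))) w :=
  (sf [:: k; l] w).2.
have ER : 'D_(delta_mx 0 i) ('D_(delta_mx 0 j) (fun w => Re (f w))) w
    = 'D_(delta_mx 0 j) ('D_(delta_mx 0 i) (fun w => Re (f w))) w.
  exact: (derive_comm (fun z => diff_derivable (d1 z).1)
    (fun z => diff_derivable (d1 z).1) (fun z => diff_derivable (dR j z))
    (fun z => diff_derivable (dR i z)) (differentiable_continuous (ddR i j))
    (differentiable_continuous (ddR j i))).
have EI : 'D_(delta_mx 0 i) ('D_(delta_mx 0 j) (fun w => Im (f w))) w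
    = 'D_(delta_mx 0 j) ('D_(delta_mx 0 i) (fun w => Im (f w))) w.
  exact: (derive_comm (fun z => diff_derivable (d1 z).2)
  (fun z => diff_derivable (d1 z).2) (fun z => diff_derivable (dI j z))
  (fun z => diff_derivable (dI i z)) (differentiable_continuous (ddI i j))
  (differentiable_continuous (ddI j i))).
exact: (congr2 (fun a b => a +i* b) ER EI).
Qed.

(** * Polynomials times a Gaussian as explicit Schwartz functions *)

Section Gaussian.
Variables (R : realType) (m : nat).
Implicit Types (P Q : {mpoly R[i][m]}) (v : 'rV[R]_m).

(** For k > 0, taking k-th roots reduces the bound to |t| <= k exp(t^2 / k). By exp(x) >= 1 + x the
    right side is at least k + t^2, and t^2 >= 2|t| - 1. *)
Lemma expr_gauss_bound (k : nat) (t : R) : `|t| ^+ k * expR (- t ^+ 2) <= k%:R ^+ k.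
Proof.
case: k => [|k]; first by rewrite !expr0 mul1r -expR0 ler_expR oppr_le0 sqr_ge0.
have k0 : 0 < k.+1%:R :> R by rewrite ltr0n.
rewrite expRN ler_pdivrMr ?expR_gt0 //.
have -> : expR (t ^+ 2) = expR (t ^+ 2 / k.+1%:R) ^+ k.+1.
  by rewrite -expRM_natl mulrC divfK ?gt_eqF.
rewrite -exprMn; apply: lerXn2r; rewrite ?nnegrE ?mulr_ge0 ?ler0n ?expR_ge0 //.
apply: (le_trans _ (ler_wpM2l (ltW k0) (expR_ge1Dx _))).
rewrite mulrDr mulr1 [X in _ <= _ + X]mulrC divfK ?gt_eqF //.
have : 1 <= k.+1%:R :> R by rewrite ler1n.
have : 0 <= (`|t| - 1) ^+ 2 := sqr_ge0 _.
rewrite sqrrB1 real_normK ?num_real // mulr2n.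
by have := normr_ge0 t; set x := `|t|; lra.
Qed.

(** A formal polynomial, so that [mpfun_partial] supplies the derivative of the exponent of the
    Gaussian. *)
Definition normsq_poly : {mpoly R[i][m]} := \sum_(j < m) 'X_j ^+ 2.

Definition gauss v : R := expR (- \sum_(j < m) v 0 j ^+ 2).

Lemma mpfun_normsq v : mpfun normsq_poly v = (\sum_(j < m) v 0 j ^+ 2)%:C.
Proof.
rewrite /mpfun /normsq_poly raddf_sum rmorph_sum; apply: eq_bigr => j _ /=.
by rewrite rmorphXn /= mevalXU rmorphXn.
Qed.

Lemma mderiv_normsq j : mderiv j normsq_poly = 2%:R *: 'X_j.
Proof.
rewrite /normsq_poly raddf_sum /= (bigD1 j) //= big1 ?addr0.
  rewrite expr2 mderivM mderivX mnm1E eqxx scale1r.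
  rewrite (_ : (_ - _)%MM = 0%MM) ?mpolyX0 ?mul1r ?mulr1 ?scaler_nat //.
  by apply/mnmP => k; rewrite mnmBE subnn mnm0E.
move=> k kj; rewrite expr2 mderivM mderivX mnm1E (negbTE kj) scale0r.
by rewrite mul0r mulr0 addr0.
Qed.

(* In dimension 0 there is no index to feed to [mpfun_partial]. *)
Lemma mpfun_cdifferentiable P v : cdifferentiable (mpfun P) v.
Proof.
case: (posnP m) => [m0|m_gt0]; last exact: (mpfun_partial P (Ordinal m_gt0)).1.
have -> : mpfun P = fun=> mpfun P 0; last exact: cdifferentiable_cst.
apply/funext => w; congr (mpfun P _); apply/rowP => -[k lt_k].
by exfalso; rewrite m0 in lt_k.
Qed.

Lemma gauss_cdifferentiable v : cdifferentiable (fun w => (gauss w)%:C) v.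
Proof.
split; last exact: differentiable_cst.
apply: (@differentiable_comp _ _ _ _ (fun w : 'rV[R]_m => - \sum_(j < m) w 0 j ^+ 2) expR).
  apply: differentiableN.
  have -> : (fun w : 'rV[R]_m => \sum_(j < m) w 0 j ^+ 2) =
    fun w => Re (mpfun normsq_poly w) by apply/funext => w; rewrite mpfun_normsq.
  exact: (mpfun_cdifferentiable normsq_poly v).1.
by apply/derivable1_diffP; exact: derivable_expR.
Qed.

Lemma gauss_partial j v : partial j (fun w => (gauss w)%:C) v
  = - (2%:R * (v 0 j)%:C) * (gauss v)%:C.
Proof.
pose h (w : 'rV[R]_m) : R := \sum_(j < m) w 0 j ^+ 2.
have howe_E : h = fun w => Re (mpfun normsq_poly w).
  by apply/funext => w; rewrite mpfun_normsq.
have [/(_ v)[dh _] pd] := mpfun_partial normsq_poly j.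
have Dh : 'D_(delta_mx 0 j) h v = 2%:R * v 0 j.
  have := congr1 (fun z => Re z) (congr1 (@^~ v) pd); rewrite /partial /= -howe_E => ->.
  rewrite mderiv_normsq /mpfun mevalZ mevalXU.
  by rewrite -[2%:R](rmorph_nat (real_complex R)) /= mul0r subr0.
rewrite -howe_E in dh.
have dN : differentiable (fun w => - h w) v by exact: differentiableN.
have DN : 'D_(delta_mx 0 j) (fun w => - h w) v = - (2%:R * v 0 j).
  have -> : (fun w => - h w) = - h by [].
  by rewrite deriveN ?Dh //; exact: diff_derivable.
have dg : differentiable gauss v := (gauss_cdifferentiable v).1.
rewrite /partial /= derive_cst.
have -> : 'D_(delta_mx 0 j) gauss v = - (2%:R * v 0 j) * gauss v.
  rewrite deriveE // (_ : gauss = expR \o (fun w => - h w)) //.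
  rewrite diff_comp //; last by apply/derivable1_diffP; exact: derivable_expR.
  rewrite diff1E; last by apply/derivable1_diffP; exact: derivable_expR.
  rewrite derive1E derive_val /=.
  by congr (_ * _); rewrite -DN deriveE.
by apply/eqP; rewrite eq_complex /=; apply/andP; split; apply/eqP; ring.
Qed.

Definition poly_gauss P v : R[i] := mpfun P v * (gauss v)%:C.

Lemma poly_gauss_partial P j :
  partial j (poly_gauss P) = poly_gauss (mderiv j P - 2%:R *: ('X_j * P)).
Proof.
apply/funext => w.
rewrite (partialM _ (mpfun_cdifferentiable P w) (gauss_cdifferentiable w)).
rewrite (mpfun_partial P j).2 gauss_partial.
rewrite /poly_gauss /mpfun mevalB mevalZ mevalM mevalXU; ring.
Qed.

Lemma poly_gauss_partials P (s : seq 'I_m) :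
  exists Q, partials s (poly_gauss P) = poly_gauss Q.
Proof.
elim: s => [|j s [Q E]]; first by exists P.
by rewrite /= -/(partials _ _) E poly_gauss_partial; eexists.
Qed.

Lemma gaussE v : gauss v = \prod_(j < m) expR (- v 0 j ^+ 2).
Proof. by rewrite /gauss -sumrN expR_sum. Qed.

(** Monomial by monomial: the Gaussian factors over the coordinates, so a monomial times it is a
    product of the one-variable functions of [expr_gauss_bound]. *)
Lemma poly_gauss_bounded P : exists B : R, forall v, `|poly_gauss P v| <= B%:C.
Proof.
rewrite [P]mpolyE; elim: (msupp P) => [|a s [B hB]].
  by exists 0 => v; rewrite big_nil /poly_gauss /mpfun meval0 mul0r normr0.
have [r cr] : exists r : R, `|P@_a| = r%:C.
  by case: (P@_a) => x y; rewrite normc_def; eexists.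
have r0 : 0 <= r by rewrite -lecR -cr normr_ge0.
exists (r * (\prod_(j < m) (a j)%:R ^+ a j) + B) => v.
rewrite big_cons /poly_gauss /mpfun mevalD mulrDl rmorphD.
apply: (le_trans (ler_normD _ _)); apply: lerD; last exact: hB.
rewrite mevalZ -mulrA normrM cr rmorphM; apply: ler_wpM2l; first by rewrite lecR.
rewrite mevalX gaussE rmorph_prod -big_split /= normr_prod rmorph_prod.
apply: ler_prod => j _; rewrite normr_ge0 /=.
have := expr_gauss_bound (a j) (v 0 j); rewrite -lecR; apply: le_trans.
rewrite normrM normrX rmorphM rmorphXn /= !normc_def /= !expr0n /= !addr0 !sqrtr_sqr.
by rewrite [`|expR _|]ger0_norm ?expR_ge0.
Qed.

(** Functions of this shape are stable under partial derivatives and under multiplication by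
    monomials, so every Schwartz seminorm is the sup norm of another such function. *)
Lemma schwartz_poly_gauss P : schwartz (poly_gauss P).
Proof.
split=> [s v|a s]; have [Q ->] := poly_gauss_partials P s.
  exact: cdifferentiableM (mpfun_cdifferentiable Q v) (gauss_cdifferentiable v).
have [B hB] := poly_gauss_bounded ('X_[a] * Q).
exists B => v; apply: le_trans (hB v).
rewrite /poly_gauss /mpfun mevalM mulrA mevalX rmorph_prod /=.
under [X in X * _ * _]eq_bigr do rewrite rmorphXn.
exact: lexx.
Qed.

End Gaussian.

(** * Pure tensors and the elementary operators on them *)

Section PureTensors.
Variables (R : realType) (n : nat).
Implicit Types (p : {mpoly R[i][n + n]}) (f g : 'rV[R]_n -> R[i]) (F G : polS R n).

Lemma polS_eqP F G : (forall z q, F z q = G z q) <-> F = G.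
Proof.
split=> [E|->//]; apply: val_inj; apply/funext => z; apply/funext => q; exact: E.
Qed.

Lemma polSD F G z q : (F + G) z q = F z q + G z q. Proof. by []. Qed.
Lemma polSZ (c : R[i]) F z q : (c *: F) z q = c * F z q. Proof. by []. Qed.
Lemma polS_sum (I : Type) (r : seq I) (P : pred I) (G : I -> polS R n) z q :
  (\sum_(i <- r | P i) G i) z q = \sum_(i <- r | P i) G i z q.
Proof. by elim/big_rec2: _ => // i y1 y2 _ <-. Qed.

Lemma ptensor_subproof p f : schwartz f ->
  (fun z q => mpfun p z * f q) \in @polS_pred R n.
Proof.
move=> sf; apply/asboolP; exists 1%N, (fun=> p), (fun=> f); split=> //.
by apply/funext => z; apply/funext => q; rewrite big_ord1.
Qed.

Definition ptensor p f (sf : schwartz f) : polS R n := PolS (ptensor_subproof p sf).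

(** Turns a function-level sum into a sum of vectors of [polS], to which linear operators can be
    applied term by term. *)
Lemma tensor_schwartzP (W : set {mpoly R[i][n + n]}) F : tensor_schwartz W F <->
  exists k (p : 'I_k -> {mpoly R[i][n + n]}) (f : 'I_k -> 'rV[R]_n -> R[i])
    (sf : forall i, schwartz (f i)),
  (forall i, W (p i)) /\ F = \sum_(i < k) ptensor (p i) (sf i).
Proof.
split=> [[k [p [f [pf E]]]]|[k [p [f [sf [Wp ->]]]]]].
  exists k, p, f, (fun i => (pf i).2); split=> [i|]; first by have [] := pf i.
  by apply/polS_eqP => z q; rewrite E polS_sum.
exists k, p, f; split=> [i|]; first by split.
by apply/funext => z; apply/funext => q; rewrite polS_sum.
Qed.

Lemma mul_z_ptensor i p f (sf : schwartz f) :
  mul_z i (ptensor p sf) = ptensor ('X_i * p) sf.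
Proof.
by apply/polS_eqP => z q; rewrite /= /mulz_fun /= /mpfun mevalM mevalXU mulrA.
Qed.

Lemma d_z_ptensor i p f (sf : schwartz f) :
  d_z i (ptensor p sf) = ptensor (mderiv i p) sf.
Proof.
apply/polS_eqP => z q; rewrite /= /dz_fun /=.
have [c d] := mpfun_partial p i.
rewrite (partialM _ (c z) (cdifferentiable_cst _ _)) partial_cst mulr0 addr0.
by rewrite d.
Qed.

Lemma mul_q_ptensor j p f (sf : schwartz f) :
  mul_q j (ptensor p sf) = ptensor p (schwartz_coordM j sf).
Proof. by apply/polS_eqP => z q; rewrite /= /mulq_fun /= mulrCA. Qed.

Lemma d_q_ptensor j p f (sf : schwartz f) :
  d_q j (ptensor p sf) = ptensor p (schwartz_partial j sf).
Proof.
apply/polS_eqP => z q; rewrite /= /dq_fun /=.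
rewrite (partialM _ (cdifferentiable_cst _ _) (sf.1 [::] q)) partial_cst mul0r.
by rewrite add0r.
Qed.

Lemma mul_z_linear i : linear (@mul_z R n i).
Proof.
by move=> c F G; apply/polS_eqP => z q; rewrite /= /mulz_fun /= mulrDr mulrCA.
Qed.

Lemma mul_q_linear j : linear (@mul_q R n j).
Proof.
by move=> c F G; apply/polS_eqP => z q; rewrite /= /mulq_fun /= mulrDr mulrCA.
Qed.

Lemma slice_z_cdifferentiable (i : 'I_(n + n)) F q z : cdifferentiable (F^~ q) z.
Proof.
have [k [p [f [_ ->]]]] := polSP F; apply: cdifferentiable_sum => l.
apply: cdifferentiableM; last exact: cdifferentiable_cst.
exact: (mpfun_partial (p l) i).1.
Qed.

Lemma slice_q_cdifferentiable F q z : cdifferentiable (F z) q.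
Proof.
have [k [p [f [sf ->]]]] := polSP F; apply: cdifferentiable_sum => i.
apply: cdifferentiableM; first exact: cdifferentiable_cst.
by have [_ [s _]] := sf i; exact: (s [::]).
Qed.

Lemma d_z_linear i : linear (@d_z R n i).
Proof.
move=> c F G; apply/polS_eqP => z q; rewrite /= /dz_fun.
have dF := slice_z_cdifferentiable i F q z.
have dG := slice_z_cdifferentiable i G q z.
have dc := cdifferentiable_cst c z.
rewrite (partialD _ (cdifferentiableM dc dF) dG) (partialM _ dc dF).
by rewrite partial_cst mul0r add0r.
Qed.

Lemma d_q_linear j : linear (@d_q R n j).
Proof.
move=> c F G; apply/polS_eqP => z q; rewrite /= /dq_fun.
have dF := slice_q_cdifferentiable F q z.
have dG := slice_q_cdifferentiable G q z.
have dc := cdifferentiable_cst c q.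
rewrite (partialD _ (cdifferentiableM dc dF) dG) (partialM _ dc dF).
by rewrite partial_cst mul0r add0r.
Qed.

(** Two computations of the same tensor carry different proofs that the second factor is Schwartz;
    this discards the difference. *)
Lemma ptensor_eq p p' f f' (sf : schwartz f) (sf' : schwartz f') :
  p = p' -> f = f' -> ptensor p sf = ptensor p' sf'.
Proof. by move=> -> Ef; apply/polS_eqP => z q; rewrite /= Ef. Qed.

Lemma ptensorDl p p' f (sf : schwartz f) :
  ptensor (p + p') sf = ptensor p sf + ptensor p' sf.
Proof. by apply/polS_eqP => z q; rewrite /= /mpfun mevalD mulrDl. Qed.

Lemma ptensorZl c p f (sf : schwartz f) :
  ptensor (c *: p) sf = c *: ptensor p sf.
Proof. by apply/polS_eqP => z q; rewrite polSZ /= /mpfun mevalZ mulrA. Qed.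

End PureTensors.

(** * The associative algebra of linear endomorphisms *)

Section Endomorphisms.
Variables (R : realType) (n : nat).
Implicit Types (f : 'rV[R]_n -> R[i]).
Local Notation V := (polS R n).

Definition lop_pred : {pred V -> V} := [pred A : V -> V | `[< linear A >]].

Record lop := Lop { lop_fun :> V -> V; lop_funP : lop_fun \in lop_pred }.

HB.instance Definition _ := [isSub for lop_fun].
HB.instance Definition _ := [Choice of lop by <:].

Lemma lop_submod_closed : submod_closed lop_pred.
Proof.
split; first by apply/asboolP => c F G; rewrite /= scaler0 addr0.
move=> a A B /asboolP lop_mpA /asboolP lop_mpB; apply/asboolP => c F G /=.
rewrite -[LHS]/(a *: A (c *: F + G) + B (c *: F + G)).
rewrite -[RHS]/(c *: (a *: A F + B F) + (a *: A G + B G)).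
by rewrite lop_mpA lop_mpB !scalerDr addrACA !scalerA [a * c]mulrC.
Qed.

HB.instance Definition _ := GRing.isSubmodClosed.Build _ _ lop_pred
  lop_submod_closed.
HB.instance Definition _ := [SubChoice_isSubLmodule of lop by <:].

Lemma lop_linear (A : lop) : linear A.
Proof. by apply/asboolP; case: A. Qed.

Lemma lopP (A B : lop) : (forall F, A F = B F) <-> A = B.
Proof. by split=> [E|->//]; apply: val_inj; apply/funext. Qed.

Lemma lop1_subproof : (idfun : V -> V) \in lop_pred.
Proof. exact/asboolP. Qed.
Definition lop1 := Lop lop1_subproof.

Lemma lopM_subproof (A B : lop) : (A \o B : V -> V) \in lop_pred.
Proof. by apply/asboolP => c F G /=; rewrite !lop_linear. Qed.
Definition lopM A B := Lop (lopM_subproof A B).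


(** The space is not zero: the Gaussian takes the value 1 at the origin, also for n = 0. *)
Lemma lop1_neq0 : lop1 != 0 :> lop.
Proof.
pose G : V := ptensor 1 (schwartz_poly_gauss (1 : {mpoly R[i][n]})).
apply/eqP => /lopP/(_ G)/polS_eqP/(_ 0 0) /= G0.
have /eqP : mpfun 1 0 * poly_gauss 1 0 = 0 :> R[i] := G0.
rewrite /poly_gauss /mpfun !meval1 !mul1r (_ : gauss 0 = 1) ?oner_eq0 //.
by rewrite /gauss big1 ?oppr0 ?expR0 // => j _; rewrite mxE expr0n.
Qed.

Lemma lopMA : associative lopM. Proof. by move=> A B D; apply/lopP. Qed.
Lemma lop1M : left_id lop1 lopM. Proof. by move=> A; apply/lopP. Qed.
Lemma lopM1 : right_id lop1 lopM. Proof. by move=> A; apply/lopP. Qed.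

Lemma lopMDl : left_distributive lopM +%R.
Proof. by move=> A B D; apply/lopP. Qed.

Lemma lopMDr : right_distributive lopM +%R.
Proof.
move=> A B D; apply/lopP => F; have := lop_linear A 1 (B F) (D F).
by rewrite !scale1r.
Qed.

HB.instance Definition _ := GRing.Zmodule_isNzRing.Build lop
  lopMA lop1M lopM1   lopMDl lopMDr lop1_neq0.


Lemma lopZAl (c : R[i]) (A B : lop) : c *: (A * B) = (c *: A) * B.
Proof. exact/lopP. Qed.

HB.instance Definition _ := GRing.Lmodule_isLalgebra.Build R[i] lop lopZAl.

HB.instance Definition _ (A : lop) :=
  GRing.isLinear.Build R[i] V V _ A (lop_linear A).

Lemma lopZAr (c : R[i]) (A B : lop) : c *: (A * B) = A * (c *: B).
Proof. by apply/lopP => F; rewrite -[RHS]/(A (c *: B F)) linearZ. Qed.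

HB.instance Definition _ := GRing.Lalgebra_isAlgebra.Build R[i] lop lopZAr.

Definition lop_mul_z i : lop := Lop (asboolT (@mul_z_linear R n i)).
Definition lop_d_z i : lop := Lop (asboolT (@d_z_linear R n i)).
Definition lop_mul_q j : lop := Lop (asboolT (@mul_q_linear R n j)).
Definition lop_d_q j : lop := Lop (asboolT (@d_q_linear R n j)).

(** Pure tensors span the space. Each canonical relation thereby splits into a statement on
    polynomials and one on Schwartz functions. *)
Lemma lop_ptensorP (A B : lop) :
  (forall p f (sf : schwartz f), A (ptensor p sf) = B (ptensor p sf)) -> A = B.
Proof.
move=> E; apply/lopP => F; have /tensor_schwartzP[k [p [f [sf [_ ->]]]]] := polSP F.
by rewrite !raddf_sum; apply: eq_bigr => i _; exact: E.
Qed.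

End Endomorphisms.

(** * Commutators in an associative algebra *)

Section Bracket.
Variables (C : comNzRingType) (A : algType C).
Implicit Types (P X Y : A) (c : C).

Definition br P X : A := P * X - X * P.

Lemma br_linear_r P c X Y : br P (c *: X + Y) = c *: br P X + br P Y.
Proof.
by rewrite /br mulrDr mulrDl -scalerAr -scalerAl scalerBr opprD addrACA.
Qed.

Lemma brC P X : br P X = - br X P. Proof. by rewrite /br opprB. Qed.

Lemma br_linear_l X c P Y : br (c *: P + Y) X = c *: br P X + br Y X.
Proof. by rewrite brC br_linear_r opprD -scalerN -!brC. Qed.

Lemma brZr P c X : br P (c *: X) = c *: br P X.
Proof. by rewrite /br -scalerAr -scalerAl scalerBr. Qed.

Lemma brDr P X Y : br P (X + Y) = br P X + br P Y.
Proof. by rewrite -[X in br P (X + _)]scale1r br_linear_r scale1r. Qed.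

Lemma brNr P X : br P (- X) = - br P X.
Proof. by rewrite -!scaleN1r brZr. Qed.

Lemma brBr P X Y : br P (X - Y) = br P X - br P Y.
Proof. by rewrite brDr brNr. Qed.

Lemma brZl P c X : br (c *: P) X = c *: br P X.
Proof. by rewrite brC brZr -scalerN -brC. Qed.

Lemma brDl P X Y : br (X + Y) P = br X P + br Y P.
Proof. by rewrite brC brDr opprD -!brC. Qed.

Lemma brBl P X Y : br (X - Y) P = br X P - br Y P.
Proof. by rewrite -scaleN1r addrC br_linear_l scaleN1r addrC. Qed.

Lemma br_sumr I (r : seq I) (Q : pred I) P (F : I -> A) :
  br P (\sum_(i <- r | Q i) F i) = \sum_(i <- r | Q i) br P (F i).
Proof. by rewrite /br mulr_sumr mulr_suml -sumrB. Qed.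

Lemma brMr P X Y : br P (X * Y) = br P X * Y + X * br P Y.
Proof. by rewrite /br mulrBl mulrBr !mulrA addrA subrK. Qed.

Lemma br_eq P X Y : br P X = Y <-> P * X = X * P + Y.
Proof.
rewrite /br; split=> [<-|->]; first by rewrite addrC subrK.
by rewrite addrAC subrr add0r.
Qed.

End Bracket.

(** * Quadratic elements and their brackets *)

Section Quadratic.
Variables (C : comNzRingType) (A : algType C) (m : nat).
Implicit Types (P : A) (V X Y : 'I_m -> A) (M N : 'M[C]_m).

Definition quad N V X : A := \sum_a \sum_b N a b *: (V a * X b).

(** The sum runs over the row index: V is read as a row vector and multiplied by M on the right, the
    convention of [Z_defining_rep]. *)
Definition lin M V (l : 'I_m) : A := \sum_k M k l *: V k.

Lemma lin0 V l : lin 0 V l = 0.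
Proof. by apply: big1 => k _; rewrite mxE scale0r. Qed.

Lemma linZ c M V l : lin (c *: M) V l = c *: lin M V l.
Proof. by rewrite scaler_sumr; apply: eq_bigr => k _; rewrite mxE scalerA. Qed.

Lemma lin1 V l : lin 1%:M V l = V l.
Proof.
rewrite /lin (bigD1 l) //= mxE eqxx scale1r big1 ?addr0 // => k kl.
by rewrite mxE (negbTE kl) scale0r.
Qed.

Lemma lin_scalar c V l : lin c%:M V l = c *: V l.
Proof. by rewrite -scalemx1 linZ lin1. Qed.

Lemma eq_quad N V V' X X' : V =1 V' -> X =1 X' -> quad N V X = quad N V' X'.
Proof.
by move=> EV EX; apply: eq_bigr => a _; apply: eq_bigr => b _; rewrite EV EX.
Qed.

Lemma quad_linear c M N V X : quad (c *: M + N) V X = c *: quad M V X + quad N V X.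
Proof.
rewrite /quad scaler_sumr -big_split; apply: eq_bigr => a _ /=.
rewrite scaler_sumr -big_split; apply: eq_bigr => b _ /=.
by rewrite !mxE scalerDl scalerA.
Qed.

Lemma quad0 V X : quad 0 V X = 0.
Proof. by apply: big1 => a _; apply: big1 => b _; rewrite mxE scale0r. Qed.

Lemma quadZ c N V X : quad (c *: N) V X = c *: quad N V X.
Proof. by rewrite -[c *: N]addr0 quad_linear quad0 addr0. Qed.

Lemma quadZl c N V X : quad N (fun a => c *: V a) X = c *: quad N V X.
Proof.
rewrite /quad scaler_sumr; apply: eq_bigr => a _; rewrite scaler_sumr.
by apply: eq_bigr => b _; rewrite -scalerAl !scalerA mulrC.
Qed.

Lemma quadZr c N V X : quad N V (fun a => c *: X a) = c *: quad N V X.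
Proof.
rewrite /quad scaler_sumr; apply: eq_bigr => a _; rewrite scaler_sumr.
by apply: eq_bigr => b _; rewrite -scalerAr !scalerA mulrC.
Qed.

Lemma quad_tr N V X : quad N^T V X = \sum_a \sum_b N a b *: (V b * X a).
Proof.
rewrite /quad exchange_big; apply: eq_bigr => a _; apply: eq_bigr => b _.
by rewrite mxE.
Qed.

Lemma quad_lin_l M N V X : quad N (lin M V) X = quad (M *m N) V X.
Proof.
rewrite /quad; under eq_bigr do under eq_bigr do rewrite mulr_suml scaler_sumr.
under eq_bigr do rewrite exchange_big; rewrite exchange_big /=.
apply: eq_bigr => k _; rewrite exchange_big; apply: eq_bigr => b _ /=.
rewrite mxE scaler_suml; apply: eq_bigr => a _.
by rewrite -scalerAl scalerA mulrC.
Qed.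

Lemma quad_lin_r M N V X : quad N V (lin M X) = quad (N *m M^T) V X.
Proof.
rewrite /quad; apply: eq_bigr => a _.
under eq_bigr do rewrite mulr_sumr scaler_sumr.
rewrite exchange_big; apply: eq_bigr => k _ /=.
rewrite mxE scaler_suml; apply: eq_bigr => b _.
by rewrite -scalerAr scalerA mxE.
Qed.

Lemma br_quad P N V X :
  br P (quad N V X) = quad N (fun a => br P (V a)) X + quad N V (fun b => br P (X b)).
Proof.
rewrite br_sumr -big_split; apply: eq_bigr => a _ /=.
rewrite br_sumr -big_split; apply: eq_bigr => b _ /=.
by rewrite brZr brMr scalerDr.
Qed.

(** The bracket is a derivation, so M enters once from each side. For N = J and M symplectic the new
    coefficient vanishes, which is the invariance of X_s and E; for symmetric N it gives the bracket
    of two elements of mp. *)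
Lemma br_quad_lin P M N V X :
  (forall l, br P (V l) = lin M V l) -> (forall l, br P (X l) = lin M X l) ->
  br P (quad N V X) = quad (M *m N + N *m M^T) V X.
Proof.
move=> EV EX; rewrite br_quad (eq_quad _ EV (frefl X)) (eq_quad _ (frefl V) EX).
by rewrite quad_lin_l quad_lin_r -[M *m N]scale1r quad_linear !scale1r.
Qed.

(** When all elementary brackets are scalars, bracketing with a quadratic element contracts one of
    its two slots. The actions of D_s, E and rho on W, D and U are all instances of this formula. *)
Lemma quad_br N V X Y (B B' : 'M[C]_m) l :
  (forall a, br (V a) (Y l) = B a l *: 1) -> (forall b, br (X b) (Y l) = B' b l *: 1) ->
  br (quad N V X) (Y l) = lin (N^T *m B) X l + lin (N *m B') V l.
Proof.
move=> EV EX; rewrite brC br_quad.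
have EV1 a : br (Y l) (V a) = - B a l *: 1 by rewrite brC EV scaleNr.
have EX1 a : br (Y l) (X a) = - B' a l *: 1 by rewrite brC EX scaleNr.
rewrite (eq_quad _ EV1 (frefl X)) (eq_quad _ (frefl V) EX1) opprD /quad /lin.
congr (_ + _).
  rewrite exchange_big -sumrN; apply: eq_bigr => b _.
  rewrite mxE scaler_suml -sumrN; apply: eq_bigr => a _.
  by rewrite -scalerAl mul1r scalerA mulrN scaleNr opprK mxE.
rewrite -sumrN; apply: eq_bigr => a _; rewrite mxE scaler_suml -sumrN.
apply: eq_bigr => b _.
by rewrite -scalerAr mulr1 scalerA mulrN scaleNr opprK.
Qed.

End Quadratic.

(* Stated for arbitrary elements so that rewriting cannot unfold the operators. *)
Lemma dirac_commute (C : comNzRingType) (A : algType C) (c : C)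
    (Ds X H K K2 W D U : A) :
  Ds * K = K2 * Ds -> K = 2%:R *: H - 1 ->
  Ds * X = X * Ds - c *: H -> Ds * W = W * Ds + c *: U ->
  Ds * U = U * Ds + c *: D -> Ds * D = D * Ds -> Ds * H = (H + 1) * Ds ->
  H * X = X * H + X -> H * D = D * H - D -> H * U = U * H ->
  exists Q, Ds * (X * X * D + W * H * K + X * U * K) = Q * Ds.
Proof.
move=> DK KE DX DW DU DD DH HX HD HU.
have T1 : Ds * (X * X * D) = X * X * D * Ds - c *: (X * D * K).
  have -> : Ds * (X * X * D) = X * X * D * Ds - c *: (X * (H * D) + H * X * D).
    rewrite !mulrA DX mulrBl -[X * Ds * X]mulrA DX mulrBl mulrBr mulrBl.
    by rewrite -!mulrA DD -!(scalerAl, scalerAr) -addrA -opprD -scalerDr !mulrA.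
  (* H raises X by one and lowers D by one, so X H D + H X D = X D (2H - 1): this is where the
     factor K originates. *)
  congr (_ - _ *: _); rewrite HX mulrDl -[X * H * D]mulrA HD mulrBr subrK.
  by rewrite KE mulrBr mulr1 -scalerAr scaler_nat mulr2n addrAC !mulrA.
have T2 : Ds * (W * H * K) = W * (H + 1) * K2 * Ds + c *: (U * H * K).
  rewrite !mulrA DW !mulrDl -!scalerAl; congr (_ + _).
  by rewrite -[W * Ds * H]mulrA DH -!mulrA DK.
have T3 : Ds * (X * U * K) = X * U * K2 * Ds
   + c *: (X * D * K) - c *: (U * H * K).
  rewrite !mulrA DX !mulrBl -!scalerAl HU; congr (_ - _).
  rewrite -[X * Ds * U]mulrA DU mulrDr mulrDl -scalerAr -scalerAl mulrA.
  by rewrite -!mulrA DK.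
(* Q has the shape of Z with H and K replaced by what they become to the left of D_s, namely H + 1
   and K2; the remaining terms of [T1], [T2] and [T3] cancel. *)
exists (X * X * D + W * (H + 1) * K2 + X * U * K2).
rewrite 2!(mulrDr Ds) T1 T2 T3 2!(mulrDl _ (_ * K2)) !addrA.
move: (c *: _) (c *: _) => y x.
by rewrite (addrAC _ _ x) (addrAC _ _ x) (addrAC _ _ x) subrK
  (addrAC _ _ (- y)) addrK.
Qed.

(** * The operators X_s, D_s, E and Z, from the canonical relations alone *)

Section HoweDuality.
Variables (C : numFieldType) (A : algType C) (n : nat) (ii : C).
Local Notation m := (n + n)%N.
Variables (J : 'M[C]_m) (W D U : 'I_m -> A).
Hypothesis ii2 : ii * ii = -1.
Hypothesis J_tr : J^T = - J.
Hypothesis J_sq : J *m J = (-1)%:M.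
Hypothesis brDW : forall a b, br (D a) (W b) = (ii * J a b) *: 1.
Hypothesis brUU : forall a b, br (U a) (U b) = (- (ii * J a b)) *: 1.
Hypothesis brWW : forall a b, br (W a) (W b) = 0.
Hypothesis brDD : forall a b, br (D a) (D b) = 0.
Hypothesis brWU : forall a b, br (W a) (U b) = 0.
Hypothesis brDU : forall a b, br (D a) (U b) = 0.

Definition howe_X : A := - ii *: quad J W U.
Definition howe_D : A := quad J D U.
Definition howe_E : A := ii *: quad J W D.
Definition howe_H : A := howe_E + n%:R *: 1.
Definition howe_K : A := 2%:R *: howe_E + (2%:R * n%:R - 1) *: 1.
Definition howe_Z l : A := howe_X * howe_X * D l + W l * howe_H * howe_K + howe_X * U l * howe_K.
Definition howe_rho (S : 'M[C]_m) : A := quad S W D - 2%:R^-1 *: quad S U U.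

Let brWD a b : br (W a) (D b) = (ii * J a b) *: 1.
Proof.
rewrite brC brDW -scaleNr; congr (_ *: _).
have := congr1 (fun M : 'M_m => M a b) J_tr; rewrite !mxE => ->.
by rewrite mulrN opprK.
Qed.
Let brUW a b : br (U a) (W b) = 0. Proof. by rewrite brC brWU oppr0. Qed.
Let brUD a b : br (U a) (D b) = 0. Proof. by rewrite brC brDU oppr0. Qed.

Let JtJ : J^T *m J = 1%:M.
Proof. by rewrite J_tr mulNmx J_sq raddfN /= opprK. Qed.

Let Z0 (V X : 'I_m -> A) : (forall a b, br (V a) (X b) = 0) ->
  forall l a, br (V a) (X l) = (0 : 'M[C]_m) a l *: 1.
Proof. by move=> h l a; rewrite h mxE scale0r. Qed.

Let ZJ (V X : 'I_m -> A) c : (forall a b, br (V a) (X b) = (c * J a b) *: 1) ->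
  forall l a, br (V a) (X l) = (c *: J) a l *: 1.
Proof. by move=> h l a; rewrite h mxE. Qed.

Lemma br_howe_D_W l : br howe_D (W l) = ii *: U l.
Proof.
rewrite (quad_br J (ZJ brDW l) (Z0 brUW l)) mulmx0 lin0 addr0.
by rewrite -scalemxAr JtJ linZ lin1.
Qed.

Let brUU' a b : br (U a) (U b) = (- ii * J a b) *: 1.
Proof. by rewrite brUU mulNr. Qed.

Lemma br_howe_D_U l : br howe_D (U l) = ii *: D l.
Proof.
rewrite (quad_br J (Z0 brDU l) (ZJ brUU' l)) mulmx0 lin0 add0r.
by rewrite -scalemxAr J_sq linZ lin_scalar scalerA mulrN1 opprK.
Qed.

Lemma br_howe_D_D l : br howe_D (D l) = 0.
Proof. by rewrite (quad_br J (Z0 brDD l) (Z0 brUD l)) !mulmx0 !lin0 addr0. Qed.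

Lemma br_howe_E_W l : br howe_E (W l) = W l.
Proof.
rewrite brZl (quad_br J (Z0 brWW l) (ZJ brDW l)) mulmx0 lin0 add0r.
rewrite -scalemxAr J_sq linZ lin_scalar !scalerA mulrN1.
by rewrite ii2 opprK scale1r.
Qed.

Lemma br_howe_E_D l : br howe_E (D l) = - D l.
Proof.
rewrite brZl (quad_br J (ZJ brWD l) (Z0 brDD l)) mulmx0 lin0 addr0.
by rewrite -scalemxAr JtJ linZ lin1 !scalerA ii2 scaleN1r.
Qed.

Lemma br_howe_E_U l : br howe_E (U l) = 0.
Proof.
by rewrite brZl (quad_br J (Z0 brWU l) (Z0 brDU l)) !mulmx0 !lin0 addr0 scaler0.
Qed.

Lemma quad0r N (X : 'I_m -> A) : quad N X (fun=> 0) = 0.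
Proof. by apply: big1 => a _; apply: big1 => b _; rewrite mulr0 scaler0. Qed.

Lemma br_howe_E_X : br howe_E howe_X = howe_X.
Proof.
rewrite brZr br_quad (eq_quad _ br_howe_E_W (frefl U)).
by rewrite (eq_quad _ (frefl W) br_howe_E_U) quad0r addr0.
Qed.

Lemma br_howe_E_howe_D : br howe_E howe_D = - howe_D.
Proof.
rewrite br_quad (eq_quad _ (frefl D) br_howe_E_U) quad0r addr0.
have E a : br howe_E (D a) = -1 *: D a by rewrite br_howe_E_D scaleN1r.
by rewrite (eq_quad _ E (frefl U)) quadZl scaleN1r.
Qed.

(** J is antisymmetric, so twice the sum is the sum of J_ab [U_a, U_b] = - i J_ab^2, that is - i
    tr(J J^T) = - 2 i n. This reordering constant is the n in E + n. *)
Lemma quadJUU : quad J U U = - (ii * n%:R) *: 1.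
Proof.
have E : quad J U U + quad J U U = \sum_a \sum_b J a b *: br (U a) (U b).
  rewrite -[X in _ + X]opprK -[- quad J U U]scaleN1r.
  have -> : -1 *: quad J U U = quad J^T U U.
    by rewrite J_tr -[- J]scaleN1r quadZ.
  rewrite quad_tr -sumrB; apply: eq_bigr => a _; rewrite -sumrB.
  by apply: eq_bigr => b _; rewrite -scalerBr.
have nz : (2%:R : C) != 0 by rewrite pnatr_eq0.
apply: (scalerI nz); rewrite scaler_nat mulr2n E.
under eq_bigr do under eq_bigr do rewrite brUU scalerA.
under eq_bigr do rewrite -scaler_suml; rewrite -scaler_suml scalerA.
congr (_ *: _); transitivity (- ii * \tr (J *m J^T)).
  rewrite /mxtrace mulr_sumr; apply: eq_bigr => a _; rewrite mxE mulr_sumr.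
  by apply: eq_bigr => b _; rewrite !mxE; ring.
rewrite J_tr mulmxN J_sq raddfN /= mxtrace_scalar.
rewrite mulNrn natrD; ring.
Qed.

Lemma br_howe_D_X : br howe_D howe_X = - ii *: howe_H.
Proof.
rewrite brZr br_quad (eq_quad _ br_howe_D_W (frefl U)) (eq_quad _ (frefl W) br_howe_D_U).
rewrite quadZl quadZr -scalerDr scalerA mulNr ii2 opprK scale1r quadJUU.
rewrite /howe_H scalerDr /howe_E !scalerA mulNr ii2 opprK scale1r addrC.
by rewrite mulNr.
Qed.

Lemma howe_KE : howe_K = 2%:R *: howe_H - 1.
Proof.
by rewrite /howe_K scalerBl scale1r addrA -scalerA -scalerDr.
Qed.

Lemma br_scalar P (c : C) : br P (c *: 1) = 0 :> A.
Proof. by rewrite brZr /br mulr1 mul1r subrr scaler0. Qed.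

Lemma br_howe_H X : br howe_H X = br howe_E X.
Proof. by rewrite brDl [X in _ + X]brC br_scalar oppr0 addr0. Qed.

Lemma howe_D_Z l : exists Q, howe_D * howe_Z l = Q * howe_D.
Proof.
(* D_s lowers the degree by one, so E becomes E + 1 and K = 2E + 2n - 1 becomes K + 2 when D_s
   passes to the right. *)
have DK : howe_D * howe_K = (howe_K + 2%:R *: 1) * howe_D.
  rewrite mulrDl -scalerAl mul1r; apply/br_eq; rewrite brC brDl brZl br_howe_E_howe_D.
  by rewrite [X in _ + X]brC br_scalar oppr0 addr0 scalerN opprK.
apply: (@dirac_commute _ _ ii howe_D howe_X howe_H howe_K _ (W l) (D l) (U l) DK howe_KE).
- by rewrite -scaleNr; apply/br_eq/br_howe_D_X.
- exact/br_eq/br_howe_D_W.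
- exact/br_eq/br_howe_D_U.
- by rewrite -[RHS]addr0; apply/br_eq/br_howe_D_D.
- by rewrite mulrDl mul1r; apply/br_eq; rewrite brC br_howe_H br_howe_E_howe_D opprK.
- by apply/br_eq; rewrite br_howe_H br_howe_E_X.
- by apply/br_eq; rewrite br_howe_H br_howe_E_D.
by rewrite -[RHS]addr0; apply/br_eq; rewrite br_howe_H br_howe_E_U.
Qed.

(** Contracting S with the brackets i J gives back M, because S J = - i M. In the U part both slots
    contract, and the factor 1/2 in [howe_rho] compensates this, so W, D and U transform by the same
    M. *)
Lemma br_howe_rho M S l : M *m J = - ii *: S -> S^T = S ->
  [/\ br (howe_rho S) (W l) = lin M W l, br (howe_rho S) (D l) = lin M D l
    & br (howe_rho S) (U l) = lin M U l].
Proof.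
move=> MS St.
have SJ : S *m J = - ii *: M.
  have -> : S = ii *: (M *m J).
    by rewrite MS scalerA mulrN ii2 opprK scale1r.
  by rewrite -scalemxAl -mulmxA J_sq mul_mx_scalar scaleN1r scalerN scaleNr.
rewrite /howe_rho !brBl !brZl; split.
- rewrite (quad_br _ (Z0 brWW l) (ZJ brDW l)) (quad_br _ (Z0 brUW l) (Z0 brUW l)).
  rewrite !mulmx0 !lin0 !addr0 add0r scaler0 subr0 -scalemxAr SJ scalerA.
  by rewrite mulrN ii2 opprK scale1r.
- rewrite (quad_br _ (ZJ brWD l) (Z0 brDD l)) (quad_br _ (Z0 brUD l) (Z0 brUD l)).
  rewrite !mulmx0 !lin0 !addr0 scaler0 subr0 St -scalemxAr SJ scalerA.
  by rewrite mulrN ii2 opprK scale1r.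
rewrite (quad_br _ (Z0 brWU l) (Z0 brDU l)) (quad_br _ (ZJ brUU' l) (ZJ brUU' l)).
rewrite !mulmx0 !lin0 !addr0 add0r St -scalemxAr SJ !linZ [- ii *: _]scalerA mulrNN ii2.
have nz : (2%:R : C) != 0 by rewrite pnatr_eq0.
rewrite scaleN1r -opprD scalerN opprK.
by rewrite -[lin M U l]scale1r -scalerDl scalerA mulVf // scale1r.
Qed.

Section Equivariance.
Variables (P : A) (M : 'M[C]_m).
Hypothesis MJ : M *m J + J *m M^T = 0.
Hypothesis PW : forall l, br P (W l) = lin M W l.
Hypothesis PD : forall l, br P (D l) = lin M D l.
Hypothesis PU : forall l, br P (U l) = lin M U l.

Lemma br_howe_Z l : br P (howe_Z l) = lin M howe_Z l.
Proof.
have PX : br P howe_X = 0 by rewrite brZr (br_quad_lin _ PW PU) MJ quad0 scaler0.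
have PE : br P howe_E = 0 by rewrite brZr (br_quad_lin _ PW PD) MJ quad0 scaler0.
have PH : br P howe_H = 0 by rewrite brDr PE br_scalar addr0.
have PK : br P howe_K = 0 by rewrite brDr brZr PE br_scalar scaler0 addr0.
rewrite /howe_Z !brDr !brMr PX PH PK PW PD PU !(mul0r, mulr0, addr0, add0r).
rewrite /lin !mulr_sumr !mulr_suml -!big_split /=; apply: eq_bigr => k _.
by rewrite -!scalerAr -!scalerAl !scalerDr.
Qed.

End Equivariance.

End HoweDuality.

(** * The canonical relations for the concrete operators *)

Section Concrete.
Variables (R : realType) (n : nat).
Local Notation L := (lop R n).
Local Notation V := (polS R n).
Local Notation C := R[i].
Local Notation m := (n + n)%N.

Lemma lopEM (A B : L) F : (A * B) F = A (B F). Proof. by []. Qed.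
Lemma lopED (A B : L) F : (A + B) F = A F + B F. Proof. by []. Qed.
Lemma lopEN (A : L) F : (- A) F = - A F. Proof. by []. Qed.
Lemma lopEZ (c : C) (A : L) F : (c *: A) F = c *: A F. Proof. by []. Qed.
Lemma lopE1 F : (1 : L) F = F. Proof. by []. Qed.

Lemma lop_fun_sum (I : Type) (r : seq I) (P : pred I) (A : I -> L) :
  lop_fun (\sum_(i <- r | P i) A i) = \sum_(i <- r | P i) lop_fun (A i).
Proof. exact: (raddf_sum (\val : L -> (V -> V))). Qed.

Lemma lop_mul_zE i (F : V) : lop_mul_z R i F = mul_z i F. Proof. by []. Qed.
Lemma lop_mul_qE j (F : V) : lop_mul_q R j F = mul_q j F. Proof. by []. Qed.
Lemma lop_d_zE i (F : V) : lop_d_z R i F = d_z i F. Proof. by []. Qed.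
Lemma lop_d_qE j (F : V) : lop_d_q R j F = d_q j F. Proof. by []. Qed.

Lemma lopE_sum (I : Type) (r : seq I) (P : pred I) (A : I -> L) F :
  (\sum_(i <- r | P i) A i) F = \sum_(i <- r | P i) A i F.
Proof. by elim/big_rec2: _ => // i y1 y2 _ <-. Qed.

Lemma howe_H_apply c N (X Y : 'I_m -> L) F : howe_H c N X Y F = howe_E c N X Y F + n%:R *: F.
Proof. by rewrite /howe_H; move: (howe_E _ _ _ _) => E; rewrite lopED lopEZ lopE1. Qed.

Lemma howe_K_apply c N (X Y : 'I_m -> L) F :
  howe_K c N X Y F = 2%:R *: howe_E c N X Y F + (2%:R * n%:R - 1) *: F.
Proof. by rewrite /howe_K; move: (howe_E _ _ _ _) => E; rewrite lopED !lopEZ lopE1. Qed.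

Lemma br_mul_z a b : br (lop_mul_z R a) (lop_mul_z R b) = 0 :> L.
Proof.
apply/br_eq; rewrite addr0; apply: lop_ptensorP => p f sf.
by rewrite !lopEM /= !mul_z_ptensor mulrCA.
Qed.

Lemma br_d_z a b : br (lop_d_z R a) (lop_d_z R b) = 0 :> L.
Proof.
apply/br_eq; rewrite addr0; apply: lop_ptensorP => p f sf.
by rewrite !lopEM /= !d_z_ptensor mderiv_comm.
Qed.

Lemma br_d_z_mul_z a b : br (lop_d_z R a) (lop_mul_z R b) = (a == b)%:R *: 1 :> L.
Proof.
apply/br_eq; apply: lop_ptensorP => p f sf.
rewrite lopED lopEZ !lopEM /= mul_z_ptensor !d_z_ptensor mul_z_ptensor.
rewrite mderivM ptensorDl addrC -ptensorZl; congr (_ + _).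
apply: (fun e => ptensor_eq sf sf e erefl).
rewrite mderivX mnm1E eq_sym; case: eqP => [->|_]; last by rewrite !scale0r mul0r.
rewrite (_ : (_ - _)%MM = 0%MM) ?mpolyX0 ?scale1r ?mul1r //.
by apply/mnmP => k; rewrite mnmBE subnn mnm0E.
Qed.

Lemma br_mul_q j k : br (lop_mul_q R j) (lop_mul_q R k) = 0 :> L.
Proof.
apply/br_eq; rewrite addr0; apply: lop_ptensorP => p f sf.
rewrite !lopEM /= !mul_q_ptensor; apply: (ptensor_eq _ _ erefl).
by apply/funext => q; rewrite mulrCA.
Qed.

Lemma br_d_q j k : br (lop_d_q R j) (lop_d_q R k) = 0 :> L.
Proof.
apply/br_eq; rewrite addr0; apply: lop_ptensorP => p f sf.
rewrite !lopEM /= !d_q_ptensor; apply: (ptensor_eq _ _ erefl).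
exact/partialC/(proj1 sf).
Qed.

Lemma br_d_q_mul_q j k : br (lop_d_q R j) (lop_mul_q R k) = (j == k)%:R *: 1 :> L.
Proof.
apply/br_eq; apply: lop_ptensorP => p f sf.
rewrite lopED lopEZ !lopEM /= mul_q_ptensor !d_q_ptensor mul_q_ptensor.
apply/polS_eqP => z q; rewrite polSD polSZ /= [_%:R * _]mulrCA -mulrDr; congr (_ * _).
rewrite (partialM _ (cdifferentiable_coord _ _) (sf.1 [::] q)) partial_coord.
by rewrite addrC.
Qed.

Lemma br_mul_z_mul_q a j : br (lop_mul_z R a) (lop_mul_q R j) = 0 :> L.
Proof.
apply/br_eq; rewrite addr0; apply: lop_ptensorP => p f sf.
by rewrite !lopEM /= !(mul_z_ptensor, mul_q_ptensor).
Qed.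

Lemma br_mul_z_d_q a j : br (lop_mul_z R a) (lop_d_q R j) = 0 :> L.
Proof.
apply/br_eq; rewrite addr0; apply: lop_ptensorP => p f sf.
by rewrite !lopEM /= !(mul_z_ptensor, d_q_ptensor).
Qed.

Lemma br_d_z_mul_q a j : br (lop_d_z R a) (lop_mul_q R j) = 0 :> L.
Proof.
apply/br_eq; rewrite addr0; apply: lop_ptensorP => p f sf.
by rewrite !lopEM /= !(d_z_ptensor, mul_q_ptensor).
Qed.

Lemma br_d_z_d_q a j : br (lop_d_z R a) (lop_d_q R j) = 0 :> L.
Proof.
apply/br_eq; rewrite addr0; apply: lop_ptensorP => p f sf.
by rewrite !lopEM /= !(d_z_ptensor, d_q_ptensor).
Qed.

Definition cJ : 'M[C]_m := map_mx (real_complex R) (sympJ R n).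
(* The rescaling makes the families W = (-i y, i x), D = (d_x, d_y) and
   U = (-i q, -d_q) transform identically under mp, with
   [D_a, W_b] = i J_ab and [U_a, U_b] = -i J_ab. *)
Definition Wop (a : 'I_m) : L :=
  match fintype.split a with
  | inl j => - 'i%C *: lop_mul_z R (rshift n j)
  | inr j => 'i%C *: lop_mul_z R (lshift n j)
  end.
Definition Uop (a : 'I_m) : L :=
  match fintype.split a with
  | inl j => - 'i%C *: lop_mul_q R j
  | inr j => - lop_d_q R j
  end.

Lemma Wop_l j : Wop (lshift n j) = - 'i%C *: lop_mul_z R (rshift n j).
Proof. by rewrite /Wop (unsplitK (inl j : 'I_n + 'I_n)). Qed.
Lemma Wop_r j : Wop (rshift n j) = 'i%C *: lop_mul_z R (lshift n j).
Proof. by rewrite /Wop (unsplitK (inr j : 'I_n + 'I_n)). Qed.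
Lemma Uop_l j : Uop (lshift n j) = - 'i%C *: lop_mul_q R j.
Proof. by rewrite /Uop (unsplitK (inl j : 'I_n + 'I_n)). Qed.
Lemma Uop_r j : Uop (rshift n j) = - lop_d_q R j.
Proof. by rewrite /Uop (unsplitK (inr j : 'I_n + 'I_n)). Qed.

Lemma cJ_block : cJ = block_mx 0 1%:M (- 1%:M) 0.
Proof. by rewrite /cJ /sympJ map_block_mx !map_mx0 map_mxN map_mx1. Qed.

Lemma cJ_ll j k : cJ (lshift n j) (lshift n k) = 0.
Proof. by rewrite cJ_block block_mxEul mxE. Qed.
Lemma cJ_lr j k : cJ (lshift n j) (rshift n k) = (j == k)%:R.
Proof. by rewrite cJ_block block_mxEur mxE. Qed.
Lemma cJ_rl j k : cJ (rshift n j) (lshift n k) = - (j == k)%:R.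
Proof. by rewrite cJ_block block_mxEdl !mxE. Qed.
Lemma cJ_rr j k : cJ (rshift n j) (rshift n k) = 0.
Proof. by rewrite cJ_block block_mxEdr mxE. Qed.

Lemma cJ_tr : cJ^T = - cJ.
Proof.
rewrite cJ_block tr_block_mx !trmx0 linearN /= trmx1 opp_block_mx !oppr0.
by rewrite opprK.
Qed.

Lemma cJ_sq : cJ *m cJ = (-1)%:M.
Proof.
rewrite cJ_block mulmx_block !mul0mx !mulmx0 !mul1mx !mulNmx mul1mx.
by rewrite !add0r !addr0 scalar_mx_block raddfN.
Qed.

Lemma sqrIi : 'i%C * 'i%C = -1 :> C.
Proof. by rewrite -expr2 sqr_i. Qed.

Lemma br_d_z_W a b : br (lop_d_z R a) (Wop b) = ('i%C * cJ a b) *: 1 :> L.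
Proof.
case: (split_ordP b) => j ->; rewrite ?Wop_l ?Wop_r brZr br_d_z_mul_z scalerA;
  congr (_ *: _); case: (split_ordP a) => k ->.
- by rewrite cJ_ll eq_lrshift !mulr0.
- by rewrite cJ_rl eq_rshift mulrN mulNr.
- by rewrite cJ_lr eq_lshift.
by rewrite cJ_rr eq_rlshift !mulr0.
Qed.

Lemma br_U_U a b : br (Uop a) (Uop b) = (- ('i%C * cJ a b)) *: 1 :> L.
Proof.
case: (split_ordP a) => j ->; case: (split_ordP b) => k ->;
  rewrite ?Uop_l ?Uop_r.
- by rewrite brZr brZl br_mul_q cJ_ll mulr0 oppr0 scale0r !scaler0.
- by rewrite brNr brZl brC br_d_q_mul_q cJ_lr scalerN opprK scalerA eq_sym mulNr.
- rewrite brZr brC brNr opprK brC br_d_q_mul_q cJ_rl scalerN -scaleNr opprK.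
  by rewrite scalerA mulrN opprK.
by rewrite brNr brC brNr br_d_q cJ_rr mulr0 !oppr0 scale0r.
Qed.

Lemma br_W_W a b : br (Wop a) (Wop b) = 0.
Proof.
rewrite /Wop; case: (fintype.split a) => j; case: (fintype.split b) => k;
  by rewrite brZr brZl br_mul_z !scaler0.
Qed.

Lemma br_W_U a b : br (Wop a) (Uop b) = 0.
Proof.
rewrite /Wop /Uop; case: (fintype.split a) => j; case: (fintype.split b) => k;
  by rewrite ?brZr ?brNr brZl ?br_mul_z_mul_q ?br_mul_z_d_q !scaler0 ?oppr0.
Qed.

Lemma br_d_z_U a b : br (lop_d_z R a) (Uop b) = 0.
Proof.
rewrite /Uop; case: (fintype.split b) => k;
  by rewrite ?brZr ?brNr ?br_d_z_mul_q ?br_d_z_d_q ?scaler0 ?oppr0.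
Qed.

End Concrete.

(** * The given operators as instances of the abstract ones *)

Section Translation.
Variables (R : realType) (n : nat).
Local Notation L := (lop R n).
Local Notation V := (polS R n).
Local Notation C := R[i].
Local Notation m := (n + n)%N.
Local Notation ii := ('i%C : C).
Local Notation J := (cJ R n).
Local Notation D := (@lop_d_z R n).
Local Notation W := (@Wop R n).
Local Notation U := (@Uop R n).
Local Notation lq := (@lop_mul_q R n).
Local Notation ldq := (@lop_d_q R n).
Local Notation lx j := (@lop_mul_z R n (lshift n j)).
Local Notation ly j := (@lop_mul_z R n (rshift n j)).
Local Notation ldx j := (@lop_d_z R n (lshift n j)).
Local Notation ldy j := (@lop_d_z R n (rshift n j)).
Local Notation HX := (howe_X ii J W U).
Local Notation HD := (howe_D J D U).
Local Notation HE := (howe_E ii J W D).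
Local Notation HH := (howe_H ii J W D).
Local Notation HK := (howe_K ii J W D).
Local Notation HZ := (howe_Z ii J W D U).

Lemma lop_funD (A B : L) : lop_fun (A + B) = lop_fun A + lop_fun B.
Proof. by []. Qed.
Lemma lop_funN (A : L) : lop_fun (- A) = - lop_fun A.
Proof. by []. Qed.
Lemma lop_funZ (c : C) (A : L) : lop_fun (c *: A) = c *: lop_fun A.
Proof. by []. Qed.
Lemma lop_funM (A B : L) : lop_fun (A * B) = lop_fun A \o lop_fun B.
Proof. by []. Qed.
Lemma lop_fun1 : lop_fun (1 : L) = idfun.
Proof. by []. Qed.
Definition lop_funE := (lop_funD, lop_funN, lop_funZ, lop_funM, lop_fun1).

Lemma quad_split (M : 'M[C]_m) (X Y : 'I_m -> L) :
  quad M X Y = \sum_j \sum_k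
    (M (lshift n j) (lshift n k) *: (X (lshift n j) * Y (lshift n k))
   + M (lshift n j) (rshift n k) *: (X (lshift n j) * Y (rshift n k))
   + M (rshift n j) (lshift n k) *: (X (rshift n j) * Y (lshift n k))
   + M (rshift n j) (rshift n k) *: (X (rshift n j) * Y (rshift n k))).
Proof.
rewrite /quad big_split_ord /= -big_split; apply: eq_bigr => j _ /=.
by rewrite !big_split_ord /= -!big_split; apply: eq_bigr => k _ /=; rewrite addrA.
Qed.

Lemma quad_cJ (X Y : 'I_m -> L) : quad J X Y =
  \sum_j (X (lshift n j) * Y (rshift n j) - X (rshift n j) * Y (lshift n j)).
Proof.
rewrite quad_split; apply: eq_bigr => j _; rewrite (bigD1 j) //= big1 ?addr0.
  rewrite cJ_ll cJ_lr cJ_rl cJ_rr eqxx !scale0r add0r addr0 scale1r.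
  by rewrite scaleN1r.
move=> k kj; rewrite cJ_ll cJ_lr cJ_rl cJ_rr eq_sym (negbTE kj).
by rewrite !scale0r oppr0 scale0r !addr0.
Qed.

Lemma howe_X_sum : HX = \sum_j (ly j * ldq j + ii *: (lx j * lq j)).
Proof.
rewrite /howe_X quad_cJ scaler_sumr; apply: eq_bigr => j _.
rewrite Wop_l Wop_r Uop_l Uop_r mulrN -!scalerAl -!scalerAr scalerBr scalerN.
rewrite !scalerA !mulNr !mulrN sqrIi !opprK.
by rewrite mulN1r scaleN1r scaleNr !opprK.
Qed.

Lemma XsE : @Xs R n = lop_fun HX.
Proof. by rewrite howe_X_sum lop_fun_sum. Qed.

Lemma DsE : @Ds R n = lop_fun HD.
Proof.
have -> : HD = \sum_j (ii *: (lq j * ldy j) - ldx j * ldq j).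
  rewrite /howe_D quad_cJ; apply: eq_bigr => j _; rewrite Uop_l Uop_r mulrN.
  rewrite -scalerAr scaleNr opprK addrC; congr (_ *: _ + _).
  (* [Ds] has q_j to the left of the derivative in y_j, [howe_D] the reverse order; the two
     commute. *)
  by have /br_eq := br_d_z_mul_q R (rshift n j) j; rewrite addr0.
by rewrite lop_fun_sum.
Qed.

Lemma EulerE : @Euler R n = lop_fun HE.
Proof.
have -> : HE = \sum_j (lx j * ldx j + ly j * ldy j).
  rewrite /howe_E quad_cJ scaler_sumr; apply: eq_bigr => j _.
  rewrite Wop_l Wop_r -!scalerAl scalerBr !scalerA mulrN sqrIi opprK scale1r.
  by rewrite scaleN1r opprK addrC.
by rewrite lop_fun_sum.
Qed.

Lemma ENE : @EN R n = lop_fun HH.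
Proof. by rewrite /EN EulerE /howe_H !lop_funE. Qed.

Lemma E2N1E : @E2N1 R n = lop_fun HK.
Proof. by rewrite /E2N1 EulerE /howe_K !lop_funE. Qed.

Lemma ZopE l : @Zop R n l = lop_fun (HZ l).
Proof.
rewrite /Zop; case: (split_ordP l) => j ->.
  rewrite /Zx XsE ENE E2N1E /howe_Z Wop_l Uop_l.
  move: HX HH HK => X H K.
  rewrite -!scalerAl -[X * (_ *: _)]scalerAr -scalerAl !scaleNr.
  by rewrite !lop_funE.
rewrite /Zy XsE ENE E2N1E /howe_Z Wop_r Uop_r.
move: HX HH HK => X H K; by rewrite -!scalerAl mulrN mulNr !lop_funE.
Qed.

Lemma lop_ker_stable (A B Q : L) F : A * B = Q * A -> A F = 0 -> A (B F) = 0.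
Proof. by move=> E AF; rewrite -lopEM E lopEM AF linear0. Qed.

Lemma Zop_KerDs l (F : V) : KerDs F -> KerDs (Zop l F).
Proof.
rewrite /KerDs /= DsE ZopE.
have [Q E] := howe_D_Z (sqrIi R) (cJ_tr R n) (cJ_sq R n) (@br_d_z_W R n)
  (@br_U_U R n) (@br_W_W R n) (@br_d_z R n) (@br_W_U R n) (@br_d_z_U R n) l.
exact: (lop_ker_stable E).
Qed.

Definition sym_coef (M : 'M[R]_m) : 'M[C]_m := ii *: (map_mx (real_complex R) M *m J).

Definition rho (M : 'M[R]_m) : V -> V := lop_fun (howe_rho W D U (sym_coef M)).

Lemma commE (A B : L) : comm (lop_fun A) (lop_fun B) = lop_fun (br A B).
Proof. by []. Qed.

(** The hypothesis and J^2 = -1 give J N J = N^T. This passes from the condition defining [sp] to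
    the transposed one that annihilates contractions with J. *)
Lemma cJ_anti (N : 'M[C]_m) : N^T *m J + J *m N = 0 -> N *m J = - (J *m N^T).
Proof.
move/eqP; rewrite addrC addr_eq0 => /eqP E.
have <- : J *m N *m J = N^T.
  by rewrite E mulNmx -mulmxA cJ_sq mul_mx_scalar scaleN1r opprK.
by rewrite !mulmxA cJ_sq mul_scalar_mx scaleN1r mulNmx opprK.
Qed.

Lemma sp_cJ M : sp M -> map_mx (real_complex R) M *m J
   = - (J *m (map_mx (real_complex R) M)^T).
Proof.
move=> spM; apply: cJ_anti; have := congr1 (map_mx (real_complex R)) spM.
by rewrite map_mxD !map_mxM map_mx0 map_trmx.
Qed.

Lemma sym_coef_spec M : sp M -> [/\ map_mx (real_complex R) M *m J = - ii *: sym_coef M,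
  (sym_coef M)^T = sym_coef M & map_mx (real_complex R) M *m J
     + J *m (map_mx (real_complex R) M)^T = 0].
Proof.
move=> spM; have E := sp_cJ spM; split.
- by rewrite /sym_coef scalerA mulNr sqrIi opprK scale1r.
- by rewrite /sym_coef linearZ /= trmx_mul cJ_tr mulNmx -E.
by rewrite E addNr.
Qed.

Lemma rho_act M : sp M -> forall l,
  [/\ br (howe_rho W D U (sym_coef M)) (W l) = lin (map_mx (real_complex R) M) W l,
   br (howe_rho W D U (sym_coef M)) (D l) = lin (map_mx (real_complex R) M) D l
 & br (howe_rho W D U (sym_coef M)) (U l) = lin (map_mx (real_complex R) M) U l].
Proof.
move=> /sym_coef_spec[E1 E2 _] l.
exact: (br_howe_rho (sqrIi R) (cJ_tr R n) (cJ_sq R n) (@br_d_z_W R n)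
  (@br_U_U R n) (@br_W_W R n) (@br_d_z R n) (@br_W_U R n) (@br_d_z_U R n)).
Qed.

Lemma rho_defining : Z_defining_rep rho.
Proof.
move=> M spM l; rewrite ZopE commE.
have hW := fun l => let: And3 h _ _ := rho_act spM l in h.
have hDD := fun l => let: And3 _ h _ := rho_act spM l in h.
have hU := fun l => let: And3 _ _ h := rho_act spM l in h.
have [_ _ MJ] := sym_coef_spec spM.
rewrite (br_howe_Z ii MJ hW hDD hU) lop_fun_sum; apply: eq_bigr => k _.
by rewrite mxE ZopE.
Qed.

End Translation.

(** * Linear independence of the Z_l, tested on a Gaussian *)

Section Independence.
Variables (R : realType) (n : nat).
Local Notation L := (lop R n).
Local Notation V := (polS R n).
Local Notation C := R[i].
Local Notation m := (n + n)%N.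
Local Notation ii := ('i%C : C).
Local Notation J := (cJ R n).
Local Notation D := (@lop_d_z R n).
Local Notation W := (@Wop R n).
Local Notation U := (@Uop R n).
Local Notation HX := (howe_X ii J W U).
Local Notation HE := (howe_E ii J W D).
Local Notation HH := (howe_H ii J W D).
Local Notation HK := (howe_K ii J W D).
Local Notation HZ := (howe_Z ii J W D U).

Local Notation pg Q := (ptensor 1 (schwartz_poly_gauss (Q : {mpoly C[n]})) : V).

Lemma gauss0 : gauss (0 : 'rV[R]_n) = 1.
Proof. by rewrite /gauss big1 ?oppr0 ?expR0 // => j _; rewrite mxE expr0n. Qed.

Lemma pg0 Q z : pg Q z 0 = mpfun Q 0.
Proof. by rewrite /= /poly_gauss /mpfun meval1 mul1r gauss0 mulr1. Qed.

Lemma d_z_pg i Q : lop_d_z R i (pg Q) = 0.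
Proof.
apply/polS_eqP => z q; rewrite lop_d_zE d_z_ptensor /=.
by rewrite -mpolyC1 mderivC /mpfun meval0 mul0r.
Qed.

Lemma mul_q_pg j Q : lop_mul_q R j (pg Q) = pg ('X_j * Q).
Proof.
rewrite lop_mul_qE mul_q_ptensor; apply: (ptensor_eq _ _ erefl).
by apply/funext => q; rewrite /poly_gauss /mpfun mevalM mevalXU mulrA.
Qed.

Lemma d_q_pg j Q : lop_d_q R j (pg Q) = pg (mderiv j Q - 2%:R *: ('X_j * Q)).
Proof.
rewrite lop_d_qE d_q_ptensor; apply: (ptensor_eq _ _ erefl).
exact: poly_gauss_partial.
Qed.

Lemma mul_z_apply i (F : V) z q : lop_mul_z R i F z q = (z 0 i)%:C * F z q.
Proof. by []. Qed.

Lemma pgZ c Q : pg (c *: Q) = c *: pg Q.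
Proof.
apply/polS_eqP => z q; rewrite polSZ /= [RHS]mulrCA; congr (_ * _).
by rewrite /poly_gauss /mpfun mevalZ mulrA.
Qed.

Lemma mderiv0_gauss k j :
  mpfun (mderiv k 'X_j - 2%:R *: ('X_k * 'X_j) : {mpoly C[n]}) 0 = (j == k)%:R.
Proof.
rewrite /mpfun mevalB mevalZ mevalM !mevalXU !mxE mul0r mulr0 subr0.
rewrite mderivX mnm1E mevalZ; case: eqP => [->|_]; last by rewrite mul0r.
rewrite (_ : (_ - _)%MM = 0%MM) ?mpolyX0 ?meval1 ?mulr1 //.
by apply/mnmP => i; rewrite mnmBE subnn mnm0E.
Qed.

(** At q = 0 every term with a factor q dies, and among the derivatives in q only the one that hits
    q_j survives. *)
Lemma howe_X_pgX j z : HX (pg 'X_j) z 0 = (z 0 (rshift n j))%:C.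
Proof.
rewrite howe_X_sum lopE_sum polS_sum (bigD1 j) // big1 => [|k kj].
  rewrite lopED lopEZ !lopEM polSD polSZ !mul_z_apply d_q_pg mul_q_pg !pg0.
  rewrite mderiv0_gauss /mpfun mevalM mevalXU mxE eqxx [LHS]addr0.
  by rewrite rmorph0 mul0r !mulr0 addr0 mulr1.
rewrite lopED lopEZ !lopEM polSD polSZ !mul_z_apply d_q_pg mul_q_pg !pg0.
rewrite mderiv0_gauss /mpfun mevalM mevalXU mxE eq_sym (negbTE kj).
by rewrite rmorph0 mul0r !mulr0 addr0.
Qed.

Lemma howe_E_pg Q : HE (pg Q) = 0.
Proof.
rewrite /howe_E lopEZ lopE_sum big1 ?scaler0 // => a _; rewrite lopE_sum big1 // => b _.
by rewrite lopEZ lopEM d_z_pg linear0 scaler0.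
Qed.

Lemma howe_H_pg Q : HH (pg Q) = n%:R *: pg Q.
Proof. by rewrite howe_H_apply howe_E_pg add0r. Qed.

Lemma howe_K_pg Q : HK (pg Q) = (2%:R * n%:R - 1) *: pg Q.
Proof. by rewrite howe_K_apply howe_E_pg scaler0 add0r. Qed.

Lemma lop_scale (A : L) c F : A (c *: F) = c *: A F.
Proof. exact: linearZ. Qed.

(** On functions constant in x and y the derivative D_l and E vanish, so H and K act as the scalars
    n and 2n - 1. *)
Lemma howe_Z_pg l z : HZ l (pg 1) z 0 =
  (2%:R * n%:R - 1) * (n%:R * W l (pg 1) z 0 + HX (U l (pg 1)) z 0).
Proof.
rewrite /howe_Z; move: howe_H_pg howe_K_pg; move: HX HH HK => X H K HG KG.
rewrite !lopED !lopEM d_z_pg !linear0 add0r KG.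
by rewrite !lop_scale HG !lop_scale polSD !polSZ -mulrDr.
Qed.

Lemma howe_Z_pg_l j z : HZ (lshift n j) (pg 1) z 0 =
  - ii * (2%:R * n%:R - 1) * (n%:R + 1) * (z 0 (rshift n j))%:C.
Proof.
rewrite howe_Z_pg; move: howe_X_pgX; move: HX => X XE.
rewrite Wop_l Uop_l !lopEZ mul_q_pg mulr1 lop_scale !polSZ XE.
rewrite mul_z_apply pg0 /mpfun meval1; ring.
Qed.

(** The coefficient 2 of y_j comes from differentiating exp(-|q|^2). This value mixes x_j and y_j,
    whereas that of [howe_Z_pg_l] is a multiple of y_j, so the system for the coefficients is
    triangular. *)
Lemma howe_Z_pg_r j z : HZ (rshift n j) (pg 1) z 0 = (2%:R * n%:R - 1) *
  (ii * n%:R * (z 0 (lshift n j))%:C + 2%:R * (z 0 (rshift n j))%:C).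
Proof.
have UG : U (rshift n j) (pg 1) = 2%:R *: pg 'X_j.
  rewrite Uop_r lopEN d_q_pg mulr1 -mpolyC1 mderivC sub0r -scaleNr pgZ scaleNr.
  by rewrite opprK.
rewrite howe_Z_pg UG; move: howe_X_pgX; move: HX => X XE.
rewrite Wop_r lopEZ lop_scale !polSZ XE mul_z_apply pg0 /mpfun meval1; ring.
Qed.

Lemma Zop_free : (0 < n)%N -> forall c : 'I_m -> C,
  \sum_l c l *: Zop l = 0 :> (V -> V) -> forall l, c l = 0.
Proof.
move=> n_gt0 c c0.
have K0 z : \sum_l c l * HZ l (pg 1) z 0 = 0.
  have : \sum_l c l *: HZ l = 0 :> L.
    apply: val_inj; rewrite /= lop_fun_sum -[RHS]c0; apply: eq_bigr => l _.
    by rewrite ZopE.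
  move/lopP/(_ (pg 1))/polS_eqP/(_ z 0); rewrite lopE_sum polS_sum.
  apply: etrans; by apply: eq_bigr => l _; rewrite lopEZ polSZ.
have K1 (z : 'rV[R]_m) :
    \sum_j c (lshift n j)
        * (- ii * (2%:R * n%:R - 1) * (n%:R + 1) * (z 0 (rshift n j))%:C)
    + \sum_j c (rshift n j) * ((2%:R * n%:R - 1) *
        (ii * n%:R * (z 0 (lshift n j))%:C + 2%:R * (z 0 (rshift n j))%:C)) = 0.
  rewrite -[RHS](K0 z) big_split_ord; congr (_ + _); apply: eq_bigr => j _.
    by rewrite howe_Z_pg_l.
  by rewrite howe_Z_pg_r.
have n0 : n%:R != 0 :> C by rewrite pnatr_eq0 -lt0n.
have k0 : 2%:R * n%:R - 1 != 0 :> C.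
  rewrite -natrM subr_eq0 (eqr_nat _ _ 1) mul2n.
  by apply/eqP => E; have := odd_double n; rewrite E.
have n10 : n%:R + 1 != 0 :> C by rewrite natr1 pnatr_eq0.
have i0 : ii != 0 by rewrite eq_complex /= oner_eq0 andbF.
(* The unit vector in direction x_j annihilates all y-terms and isolates c_{n+j}; once these
   coefficients vanish, the one in direction y_j isolates c_j. *)
have cr j : c (rshift n j) = 0.
  have := K1 (delta_mx 0 (lshift n j)); rewrite big1 => [|k _]; last first.
    by rewrite mxE eq_rlshift andbF rmorph0 !mulr0.
  rewrite add0r (bigD1 j) // big1 => [|k kj]; last first.
    rewrite !mxE eq_rlshift eq_lshift (negbTE kj) !andbF rmorph0.
    by rewrite !mulr0 addr0 !mulr0.
  rewrite !mxE !eqxx eq_rlshift andbF rmorph0 rmorph1 !mulr0 mulr1 [X in X = _]addr0.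
  rewrite addr0 => /eqP.
  by rewrite !mulf_eq0 (negbTE n0) (negbTE k0) (negbTE i0) !orbF => /eqP.
have cl j : c (lshift n j) = 0.
  have := K1 (delta_mx 0 (rshift n j)); rewrite [X in _ + X]big1 => [|k _]; last first.
    by rewrite cr mul0r.
  rewrite addr0 (bigD1 j) // big1 => [|k kj]; last first.
    by rewrite !mxE eq_rshift (negbTE kj) andbF rmorph0 !mulr0.
  rewrite !mxE !eqxx rmorph1 mulr1 [X in X = _]addr0 => /eqP.
  rewrite !(mulf_eq0, oppr_eq0) (negbTE n10) (negbTE k0) (negbTE i0).
  by rewrite !orbF => /eqP.
by move=> l; case: (split_ordP l) => j ->.
Qed.

End Independence.

(** * Degrees in x and y *)

Section Homogeneity.
Variables (R : realType) (n : nat).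
Local Notation L := (lop R n).
Local Notation V := (polS R n).
Local Notation C := R[i].
Implicit Types (h : nat) (F G : V).

Definition hom h F := tensor_schwartz [set p | p \is h.-homog] F.

Lemma tensor_schwartz_sum (P : set {mpoly C[n + n]}) (I : Type) (r : seq I)
    (G : I -> V) :
  (forall i, tensor_schwartz P (G i)) -> tensor_schwartz P (\sum_(i <- r) G i).
Proof.
move=> hG; elim/big_ind: _ => //; first exact: tensor_schwartz0.
by move=> F F' hF hF'; exact: tensor_schwartzD hF hF'.
Qed.

Lemma tensor_schwartz_ptensor (P : set {mpoly C[n + n]}) p f (sf : schwartz f) :
  P p -> tensor_schwartz P (ptensor p sf).
Proof.
move=> Pp; apply/tensor_schwartzP; exists 1%N, (fun=> p), (fun=> f), (fun=> sf).
by rewrite big_ord1.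
Qed.

Lemma lop_tensor_schwartz (P P' : set {mpoly C[n + n]}) (A : L) F :
  (forall p f (sf : schwartz f), P p -> tensor_schwartz P' (A (ptensor p sf))) ->
  tensor_schwartz P F -> tensor_schwartz P' (A F).
Proof.
move=> hA /tensor_schwartzP[k [p [f [sf [Pp ->]]]]].
by rewrite raddf_sum; apply: tensor_schwartz_sum => i; exact: hA.
Qed.

Lemma homD h F G : hom h F -> hom h G -> hom h (F + G).
Proof. exact: tensor_schwartzD. Qed.

Lemma hom0 h : hom h 0. Proof. exact: tensor_schwartz0. Qed.

Lemma homZ h c F : hom h F -> hom h (c *: F).
Proof.
move=> hF; apply: (@lop_tensor_schwartz _ _ (c *: 1)) hF => p f sf hp.
rewrite lopEZ lopE1 -ptensorZl; apply: tensor_schwartz_ptensor.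
exact: dhomogZ.
Qed.

Lemma hom_mul_z h i F : hom h F -> hom h.+1 (lop_mul_z R i F).
Proof.
apply: lop_tensor_schwartz => p f sf hp; rewrite lop_mul_zE mul_z_ptensor.
apply: tensor_schwartz_ptensor; rewrite /= -add1n; apply: dhomogM => //.
by rewrite dhomogX; apply/eqP/mdeg1.
Qed.

Lemma hom_mul_q h j F : hom h F -> hom h (lop_mul_q R j F).
Proof.
apply: lop_tensor_schwartz => p f sf hp; rewrite lop_mul_qE mul_q_ptensor.
exact: tensor_schwartz_ptensor.
Qed.

Lemma hom_d_q h j F : hom h F -> hom h (lop_d_q R j F).
Proof.
apply: lop_tensor_schwartz => p f sf hp; rewrite lop_d_qE d_q_ptensor.
exact: tensor_schwartz_ptensor.
Qed.

(** Degree 0 is kept apart because there the derivative vanishes outright; truncated subtraction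
    would leave the degree unchanged. *)
Lemma dhomog_mderiv m h (p : {mpoly C[m]}) i :
  p \is h.-homog -> if h is h'.+1 then mderiv i p \is h'.-homog else mderiv i p = 0.
Proof.
move=> hp; rewrite (mpolyE p) raddf_sum /=.
have hm (a : 'X_{1..m}) : a \in msupp p -> mdeg a = h by apply/dhomogP.
case: h hp hm => [|h] hp hm.
  rewrite big_seq big1 // => a /hm /eqP; rewrite mdeg_eq0 => /eqP ->.
  by rewrite mderivZ mpolyX0 mderivC scaler0.
rewrite big_seq; apply: rpred_sum => a /hm ha.
rewrite mderivZ mderivX; apply: rpredZ.
(* If the variable is absent, the exponent [a - U_(i)] is truncated and has the wrong degree, but
   its coefficient [a i] is 0. *)
case: (posnP (a i)) => [->|ai]; first by rewrite scale0r rpred0.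
apply: rpredZ; rewrite dhomogX; apply/eqP => /=.
have E : (U_(i) + (a - U_(i)))%MM = a.
  by rewrite addmC submK // lep1mP -lt0n.
by move: ha; rewrite -{1}E mdegD mdeg1 add1n => -[].
Qed.

Lemma hom_d_z h i F : hom h.+1 F -> hom h (lop_d_z R i F).
Proof.
apply: lop_tensor_schwartz => p f sf hp; rewrite lop_d_zE d_z_ptensor.
by apply: tensor_schwartz_ptensor; exact: (dhomog_mderiv i hp).
Qed.

Lemma hom0_d_z i F : hom 0 F -> lop_d_z R i F = 0.
Proof.
move=> /tensor_schwartzP[k [p [f [sf [hp ->]]]]].
rewrite raddf_sum big1 // => l _; rewrite -[LHS]/(d_z i _) d_z_ptensor (dhomog_mderiv i (hp l)).
by apply/polS_eqP => z q; rewrite /= /mpfun meval0 mul0r.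
Qed.

Lemma hom_W h a F : hom h F -> hom h.+1 (Wop R a F).
Proof.
rewrite /Wop => hF; case: (fintype.split a) => j; rewrite lopEZ;
  by apply/homZ/hom_mul_z.
Qed.

Lemma hom_U h a F : hom h F -> hom h (Uop R a F).
Proof.
rewrite /Uop => hF; case: (fintype.split a) => j.
  by rewrite lopEZ; apply/homZ/hom_mul_q.
by rewrite lopEN -scaleN1r; apply/homZ/hom_d_q.
Qed.

Lemma hom_quad h N (X Y : 'I_(n + n) -> L) F :
  (forall a b, hom h (X a (Y b F))) -> hom h (quad N X Y F).
Proof.
move=> hXY; rewrite lopE_sum; apply: tensor_schwartz_sum => a.
rewrite lopE_sum; apply: tensor_schwartz_sum => b.
by rewrite lopEZ lopEM; exact: homZ.
Qed.

Lemma hom_W_d_z h a b F : hom h F -> hom h (Wop R a (lop_d_z R b F)).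
Proof.
case: h => [|h] hF; last exact/hom_W/hom_d_z.
by rewrite hom0_d_z // linear0; exact: hom0.
Qed.

Local Notation W := (@Wop R n).
Local Notation U := (@Uop R n).
Local Notation D := (@lop_d_z R n).

Lemma hom_howe_X c N h F : hom h F -> hom h.+1 (howe_X c N W U F).
Proof.
move=> hF; rewrite /howe_X lopEZ; apply/homZ/hom_quad => a b.
exact/hom_W/hom_U.
Qed.

Lemma hom_howe_E c N h F : hom h F -> hom h (howe_E c N W D F).
Proof.
move=> hF; rewrite /howe_E lopEZ; apply/homZ/hom_quad => a b.
exact: hom_W_d_z.
Qed.

Lemma hom_howe_H c N h F : hom h F -> hom h (howe_H c N W D F).
Proof.
move=> hF; rewrite howe_H_apply; apply: homD; last exact: homZ.
exact: hom_howe_E.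
Qed.

Lemma hom_howe_K c N h F : hom h F -> hom h (howe_K c N W D F).
Proof.
move=> hF; rewrite howe_K_apply; apply: homD; last exact: homZ.
exact/homZ/hom_howe_E.
Qed.

Lemma hom_howe_Z c N l h F : hom h F -> hom h.+1 (howe_Z c N W D U l F).
Proof.
move=> hF; rewrite /howe_Z !lopED !lopEM; apply: homD; first apply: homD.
- case: h hF => [|h] hF; last exact/hom_howe_X/hom_howe_X/hom_d_z.
  by rewrite hom0_d_z // !linear0; exact: hom0.
- exact/hom_W/hom_howe_H/hom_howe_K.
exact/hom_howe_X/hom_U/hom_howe_K.
Qed.

End Homogeneity.

(** * Linearity, brackets and injectivity of rho; its value on block matrices *)

(** The comparison of coefficients for [howe_rho_block]. The eight operator products are replaced by
    arbitrary vectors, which leaves scalar identities modulo i^2 = -1. *)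
Lemma quadratic_normal_form (R : realType) (Z : lmodType R[i]) (a a' b c : R[i])
    (yx yy xx xy qq qd dq dd : Z) :
  (- ('i%C * b) * - 'i%C) *: yx + ('i%C * a * - 'i%C) *: yy
  + ('i%C * a' * 'i%C) *: xx + ('i%C * c * 'i%C) *: xy
  - 2%:R^-1 *: ((- ('i%C * b) * - 'i%C * - 'i%C) *: qq - ('i%C * a * - 'i%C) *: qd
    - ('i%C * a' * - 'i%C) *: dq - - (('i%C * c) *: dd)) =
  a' *: (- xx + 2%:R^-1 *: dq) + c *: (- xy - ('i%C / 2%:R) *: dd)
  + b *: (- yx - ('i%C / 2%:R) *: qq) + a *: (yy + 2%:R^-1 *: qd).
Proof.
have i2 : 'i%C * 'i%C = -1 :> R[i] := sqrIi R.
rewrite !(scalerDr, scalerN, opprD, opprK, scalerA) -!scaleNr !addrA.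
move: 'i%C i2 => i i2; move: (2%:R^-1) => h.
(* The permutation lists the right-hand terms in the order of the left: yx, yy, xx, xy, qq, qd, dq,
   dd. *)
rewrite [RHS](ACl (5*7*1*3*6*8*2*4)) /=.
have mulE (x y : R[i]) : x *: (y : R[i]^o) = x * y by [].
do 7! (congr (_ + _); last by congr (_ *: _); rewrite ?mulE; ring: i2).
by congr (_ *: _); rewrite mulE; ring: i2.
Qed.

Section Isomorphism.
Variables (R : realType) (n : nat).
Local Notation L := (lop R n).
Local Notation V := (polS R n).
Local Notation C := R[i].
Local Notation m := (n + n)%N.
Local Notation ii := ('i%C : C).
Local Notation J := (cJ R n).
Local Notation D := (@lop_d_z R n).
Local Notation W := (@Wop R n).
Local Notation U := (@Uop R n).
Local Notation lq := (@lop_mul_q R n).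
Local Notation ldq := (@lop_d_q R n).
Local Notation lx j := (@lop_mul_z R n (lshift n j)).
Local Notation ly j := (@lop_mul_z R n (rshift n j)).
Local Notation ldx j := (@lop_d_z R n (lshift n j)).
Local Notation ldy j := (@lop_d_z R n (rshift n j)).
Local Notation hr M := (howe_rho W D U (sym_coef M)).

Lemma sym_coef_linear (a : R) M N : sym_coef (a *: M + N) = a%:C *: sym_coef M + sym_coef N
  :> 'M[C]_m.
Proof.
rewrite /sym_coef map_mxD map_mxZ mulmxDl -scalemxAl scalerDr !scalerA.
by rewrite [ii * _]mulrC.
Qed.

Lemma howe_rho_linear (c : C) S T :
  howe_rho W D U (c *: S + T) = c *: howe_rho W D U S + howe_rho W D U T.
Proof.
rewrite /howe_rho !quad_linear scalerDr scalerBr opprD addrACA !scalerA.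
by rewrite [c * _]mulrC.
Qed.

Lemma rho_linear (a : R) M N : rho (a *: M + N) = a%:C *: rho M + rho N :> (V -> V).
Proof. by rewrite /rho sym_coef_linear howe_rho_linear lop_funD lop_funZ. Qed.

Lemma rho0 : rho 0 = 0 :> (V -> V).
Proof.
have := rho_linear (-1) 0 0; rewrite scaler0 addr0 rmorphN1 scaleN1r.
by rewrite addNr.
Qed.

(** Since rho(M) acts on W, D and U through M, the coefficient S = i N J of rho(N) turns into M S +
    S M^T, which is i (M N - N M) J because J M^T = - M J. *)
Lemma rho_bracket M N : sp M -> sp N ->
  rho (M *m N - N *m M) = comm (rho M) (rho N) :> (V -> V).
Proof.
move=> spM spN; rewrite /rho commE; congr lop_fun.
have hW := fun l => let: And3 h _ _ := rho_act spM l in h.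
have hDD := fun l => let: And3 _ h _ := rho_act spM l in h.
have hU := fun l => let: And3 _ _ h := rho_act spM l in h.
rewrite [in RHS]/howe_rho brBr brZr (br_quad_lin _ hW hDD) (br_quad_lin _ hU hU).
rewrite -/(howe_rho W D U _); congr howe_rho.
rewrite /sym_coef -scalemxAr -scalemxAl -scalerDr; congr (_ *: _).
rewrite map_mxB !map_mxM mulmxBl -!mulmxA; congr (_ + _).
by rewrite sp_cJ // !mulmxN opprK.
Qed.

(** The operator rho(M) determines its commutator with Z_l, whose coordinates in the independent Z_k
    are column l of M. *)
Lemma rho_inj : (0 < n)%N -> {in sp (R:=R) (n:=n) &, injective (@rho R n)}.
Proof.
move=> n_gt0 M N; rewrite !inE => spM spN E; apply/matrixP => k l.
have : \sum_k ((M k l)%:C - (N k l)%:C) *: Zop k = 0 :> (V -> V).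
  under eq_bigr do rewrite scalerBl; rewrite sumrB.
  by rewrite -(rho_defining spM) -(rho_defining spN) E subrr.
move/(Zop_free n_gt0)/(_ k)/eqP; rewrite -rmorphB => /eqP[] /eqP.
by rewrite subr_eq0 => /eqP.
Qed.

Definition lop_mpA j k : L := - (lx j * ldx k) + ly k * ldy j + lq k * ldq j
  + (2%:R^-1 * (j == k)%:R) *: 1.
(** Two-index form of the generators: the diagonal gives [mpB j], and the negative of the
    symmetrised sum gives [mpB2 j k], so a symmetric matrix can be paired with it uniformly. *)
Definition lop_mpB j k : L := - (lx j * ldy k) - (ii / 2%:R) *: (ldq j * ldq k).
Definition lop_mpC j k : L := - (ly j * ldx k) - (ii / 2%:R) *: (lq j * lq k).

Lemma sym_coef_block (a b c : 'M[R]_n) : sym_coef (block_mx a b c (- a^T)) =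
  ii *: map_mx (real_complex R) (block_mx (- b) a a^T c).
Proof.
rewrite /sym_coef; congr (_ *: _); rewrite cJ_block !map_block_mx mulmx_block.
by rewrite !mulmx0 !mulmx1 !mulmxN !mulmx1 !add0r !addr0 !map_mxN opprK.
Qed.

Lemma howe_rho_block (a b c : 'M[R]_n) : hr (block_mx a b c (- a^T)) =
  \sum_j \sum_k ((a k j)%:C *: lop_mpA j k + (c j k)%:C *: lop_mpB j k + (b j k)%:C *: lop_mpC j k).
Proof.
have two0 : (2%:R : C) != 0 by rewrite pnatr_eq0.
rewrite sym_coef_block; set S := (_ *: map_mx _ _).
(* Each [lop_mpA j k] is shared by the two off-diagonal blocks of S. Averaging q_k d_q_j and d_q_j
   q_k, which differ by delta_jk, produces the constant delta_jk / 2 of the generator. *)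
pose lr j k : L := (a j k)%:C *: (ly j * ldy k + 2%:R^-1 *: (lq j * ldq k)).
pose rl j k : L := (a k j)%:C *: (- (lx j * ldx k) + 2%:R^-1 *: (ldq j * lq k)).
have EA j k : (a k j)%:C *: lop_mpA j k = rl j k + lr k j.
  rewrite -scalerDr; congr (_ *: _); rewrite addrACA /lop_mpA -[LHS]addrA; congr (_ + _).
  have /br_eq -> := br_d_q_mul_q R j k.
  rewrite -scalerDr addrAC scalerDr scalerA; congr (_ + _).
  by rewrite -{2 3}[lq k * ldq j]scale1r -scalerDl scalerA mulVf // scale1r.
have -> : \sum_j \sum_k ((a k j)%:C *: lop_mpA j k + (c j k)%:C *: lop_mpB j k
      + (b j k)%:C *: lop_mpC j k)
  = \sum_j \sum_k (rl j k + (c j k)%:C *: lop_mpB j k + (b j k)%:C *: lop_mpC j k)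
    + \sum_j \sum_k lr j k.
  rewrite [X in _ + X]exchange_big -big_split; apply: eq_bigr => j _ /=.
  rewrite -big_split; apply: eq_bigr => k _ /=.
  by rewrite EA (addrAC (rl j k)) [LHS]addrAC.
rewrite -big_split /howe_rho !quad_split scaler_sumr -sumrB; apply: eq_bigr => j _ /=.
rewrite -big_split scaler_sumr -sumrB; apply: eq_bigr => k _ /=.
have -> : S (lshift n j) (lshift n k) = - (ii * (b j k)%:C).
  by rewrite 2!mxE block_mxEul mxE rmorphN mulrN.
have -> : S (lshift n j) (rshift n k) = ii * (a j k)%:C.
  by rewrite 2!mxE block_mxEur.
have -> : S (rshift n j) (lshift n k) = ii * (a k j)%:C.
  by rewrite 2!mxE block_mxEdl mxE.
have -> : S (rshift n j) (rshift n k) = ii * (c j k)%:C.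
  by rewrite 2!mxE block_mxEdr.
rewrite !(Wop_l, Wop_r, Uop_l, Uop_r).
rewrite -!(scalerAl, scalerAr) !(mulrN, mulNr) !scalerN !scalerA.
rewrite /rl /lr /lop_mpB /lop_mpC; exact: quadratic_normal_form.
Qed.

End Isomorphism.

(** * The image of sp under rho is mp *)

Section Surjectivity.
Variables (R : realType) (n : nat).
Local Notation L := (lop R n).
Local Notation V := (polS R n).
Local Notation C := R[i].
Local Notation m := (n + n)%N.
Local Notation ii := ('i%C : C).
Local Notation W := (@Wop R n).
Local Notation U := (@Uop R n).
Local Notation D := (@lop_d_z R n).
Local Notation lA := (@lop_mpA R n).
Local Notation lB := (@lop_mpB R n).
Local Notation lC := (@lop_mpC R n).
Local Notation hr M := (howe_rho W D U (sym_coef M)).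

Lemma sp_block (a b c d : 'M[R]_n) :
  sp (block_mx a b c d) <-> [/\ c^T = c, b^T = b & d = - a^T].
Proof.
rewrite /sp /= /sympJ tr_block_mx !mulmx_block add_block_mx.
rewrite !mulmx0 !mul0mx !mulmx1 !mul1mx !mulmxN !mulNmx !mulmx1 !mul1mx.
rewrite !add0r !addr0 -[X in _ = X]block_mx0; split.
  move/eq_block_mx => [Ec Ed _ Eb]; split.
  - by apply/eqP; rewrite eq_sym -subr_eq0 addrC Ec.
  - by apply/eqP; rewrite -subr_eq0 Eb.
  by apply/eqP; rewrite -addr_eq0 addrC Ed.
move=> [Ec Eb ->]; rewrite Ec Eb raddfN /= trmxK opprK.
by rewrite !addNr !subrr.
Qed.

Lemma sp_linear (a : R) (M N : 'M[R]_m) : sp M -> sp N -> sp (a *: M + N).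
Proof.
rewrite /sp /= => hM hN.
rewrite linearD linearZ /= mulmxDl mulmxDr -scalemxAl -scalemxAr addrACA.
by rewrite -scalerDr hM hN scaler0 addr0.
Qed.

Lemma sp0 : sp (0 : 'M[R]_m).
Proof. by rewrite /sp /= trmx0 mul0mx mulmx0 addr0. Qed.

Lemma mp0 : mp (0 : V -> V).
Proof. by exists 0%N, (fun=> 0), (fun=> idfun); split; [case|rewrite big_ord0]. Qed.

Lemma mpD (A B : V -> V) : mp A -> mp B -> mp (A + B).
Proof.
move=> [k [a [G [hG ->]]]] [l [b [G' [hG' ->]]]].
exists (k + l)%N,
  (fun i => match fintype.split i with inl i => a i | inr i => b i end),
  (fun i => match fintype.split i with inl i => G i | inr i => G' i end).
split=> [i|]; first by case: (fintype.split i).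
rewrite big_split_ord; congr (_ + _); apply: eq_bigr => i _ /=.
  by rewrite (unsplitK (inl i : 'I_k + 'I_l)).
by rewrite (unsplitK (inr i : 'I_k + 'I_l)).
Qed.

Lemma mpZ (c : R) (A : V -> V) : mp A -> mp (c%:C *: A).
Proof.
move=> [k [a [G [hG ->]]]]; exists k, (fun i => c * a i), G; split=> //.
by rewrite scaler_sumr; apply: eq_bigr => i _; rewrite rmorphM scalerA.
Qed.

Lemma mp_gen (A : V -> V) : mp_generator A -> mp A.
Proof.
move=> gA; exists 1%N, (fun=> 1), (fun=> A); split=> //.
by rewrite big_ord1 rmorph1 scale1r.
Qed.

Lemma mp_sum (I : Type) (r : seq I) (F : I -> V -> V) :
  (forall i, mp (F i)) -> mp (\sum_(i <- r) F i).
Proof.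
by move=> hF; elim/big_ind: _ => //; [exact: mp0 | exact: mpD].
Qed.

Lemma mpAE (j k : 'I_n) : mpA j k = lop_fun (lA j k).
Proof. by rewrite /mpA /lop_mpA !lop_funE. Qed.

Lemma mpBE (j : 'I_n) : mpB j = lop_fun (lB j j).
Proof. by rewrite /mpB /lop_mpB !lop_funE. Qed.

Lemma mpCE (j : 'I_n) : mpC j = lop_fun (lC j j).
Proof. by rewrite /mpC /lop_mpC !lop_funE. Qed.

Lemma half_sum (X : L) (c : C) : c / 2%:R *: X + c / 2%:R *: X = c *: X.
Proof. by rewrite -scalerDl -splitr. Qed.

Lemma mpB2E (j k : 'I_n) : mpB2 j k = lop_fun (- (lB j k + lB k j)).
Proof.
have -> : - (lB j k + lB k j) =
    lop_mul_z R (lshift n k) * lop_d_z R (rshift n j)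
    + lop_mul_z R (lshift n j) * lop_d_z R (rshift n k)
    + ii *: (lop_d_q R j * lop_d_q R k).
  have /br_eq := br_d_q R k j; rewrite addr0 /lop_mpB => ->.
  by rewrite addrACA -!opprD opprK half_sum [X in X + _]addrC.
by rewrite /mpB2 !lop_funE.
Qed.

Lemma mpC2E (j k : 'I_n) : mpC2 j k = lop_fun (- (lC j k + lC k j)).
Proof.
have -> : - (lC j k + lC k j) =
    lop_mul_z R (rshift n k) * lop_d_z R (lshift n j)
    + lop_mul_z R (rshift n j) * lop_d_z R (lshift n k)
    + ii *: (lop_mul_q R j * lop_mul_q R k).
  have /br_eq := br_mul_q R k j; rewrite addr0 /lop_mpC => ->.
  by rewrite addrACA -!opprD opprK half_sum [X in X + _]addrC.
by rewrite /mpC2 !lop_funE.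
Qed.

Definition rpair (c : 'M[R]_n) (F : 'I_n -> 'I_n -> L) : L :=
  \sum_j \sum_k (c j k)%:C *: F j k.

Lemma rpair0 F : rpair 0 F = 0.
Proof.
by apply: big1 => j _; apply: big1 => k _; rewrite mxE rmorph0 scale0r.
Qed.

Lemma rpair_linear (a : R) c d F :
  rpair (a *: c + d) F = a%:C *: rpair c F + rpair d F.
Proof.
rewrite /rpair scaler_sumr -big_split; apply: eq_bigr => j _ /=.
rewrite scaler_sumr -big_split; apply: eq_bigr => k _ /=.
by rewrite !mxE rmorphD rmorphM scalerDl scalerA.
Qed.

Lemma rpairD c d F : rpair (c + d) F = rpair c F + rpair d F.
Proof. by rewrite -[c]scale1r rpair_linear rmorph1 !scale1r. Qed.

Lemma rpairN c F : rpair (- c) F = - rpair c F.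
Proof.
by rewrite -scaleN1r -[X in rpair X]addr0 rpair_linear rpair0 addr0 rmorphN1 scaleN1r.
Qed.

Lemma rpair_delta j k F : rpair (delta_mx j k) F = F j k.
Proof.
rewrite /rpair (bigD1 j) //= [X in _ + X]big1 ?addr0 => [|j' jj']; last first.
  by apply: big1 => k' _; rewrite mxE (negbTE jj') rmorph0 scale0r.
rewrite (bigD1 k) //= big1 ?addr0 => [|k' kk']; last first.
  by rewrite mxE (negbTE kk') andbF rmorph0 scale0r.
by rewrite mxE !eqxx rmorph1 scale1r.
Qed.

Lemma howe_rho_rpair (a b c : 'M[R]_n) : hr (block_mx a b c (- a^T)) =
  rpair a^T lA + rpair c lB + rpair b lC.
Proof.
rewrite howe_rho_block /rpair -!big_split; apply: eq_bigr => j _ /=.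
by rewrite -!big_split; apply: eq_bigr => k _ /=; rewrite mxE.
Qed.

(** For symmetric c the pairing is half the pairing with F_jk + F_kj, and only these symmetrised
    operators are known to lie in mp; the factor 1/2 is real, as mp demands. *)
Lemma mp_rpair_sym (c : 'M[R]_n) F : c^T = c ->
  (forall j k, mp (lop_fun (F j k + F k j))) -> mp (lop_fun (rpair c F)).
Proof.
move=> cT hF.
have -> : rpair c F = (2%:R^-1 : R)%:C *: \sum_j \sum_k (c j k)%:C *: (F j k + F k j).
  have -> : \sum_j \sum_k (c j k)%:C *: (F j k + F k j) = rpair c F + rpair c F.
    rewrite /rpair [X in _ = _ + X]exchange_big -big_split; apply: eq_bigr => j _ /=.
    rewrite -big_split; apply: eq_bigr => k _ /=.
    have -> : c k j = c j k by rewrite -{1}cT mxE.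
    by rewrite scalerDr.
  rewrite -{2 3}[rpair c F]scale1r -scalerDl scalerA.
  have -> : (1 + 1 : C) = (2%:R : R)%:C by rewrite rmorph_nat.
  by rewrite -rmorphM mulVf ?pnatr_eq0 // rmorph1 scale1r.
rewrite lop_funZ; apply: mpZ; rewrite lop_fun_sum; apply: mp_sum => j.
rewrite lop_fun_sum; apply: mp_sum => k; rewrite lop_funZ; exact: mpZ.
Qed.

Lemma mpN (A : V -> V) : mp A -> mp (- A).
Proof. by move/(mpZ (-1)); rewrite rmorphN1 scaleN1r. Qed.

Lemma mp_lop_mpB j k : mp (lop_fun (lB j k + lB k j)).
Proof.
have [->|jk] := eqVneq j k.
  by rewrite lop_funD -mpBE; apply: mpD; apply/mp_gen/MpB.
by rewrite -[_ + _]opprK lop_funN -mpB2E; apply/mpN/mp_gen/MpB2.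
Qed.

Lemma mp_lop_mpC j k : mp (lop_fun (lC j k + lC k j)).
Proof.
have [->|jk] := eqVneq j k.
  by rewrite lop_funD -mpCE; apply: mpD; apply/mp_gen/MpC.
by rewrite -[_ + _]opprK lop_funN -mpC2E; apply/mpN/mp_gen/MpC2.
Qed.

Lemma mp_rho (M : 'M[R]_m) : sp M -> mp (rho M).
Proof.
rewrite -(submxK M) => /sp_block[cT bT ->]; rewrite /rho howe_rho_rpair !lop_funD.
apply: mpD; first apply: mpD.
- rewrite lop_fun_sum; apply: mp_sum => j; rewrite lop_fun_sum; apply: mp_sum => k.
  by rewrite lop_funZ -mpAE; apply/mpZ/mp_gen/MpA.
- exact: mp_rpair_sym mp_lop_mpB.
exact: mp_rpair_sym mp_lop_mpC.
Qed.

Lemma rho_surj (A : V -> V) : mp A -> exists2 M, sp M & rho M = A.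
Proof.
have blk (a b c : 'M[R]_n) X : b^T = b -> c^T = c ->
    X = rpair a^T lA + rpair c lB + rpair b lC ->
    exists2 M, sp M & rho M = lop_fun X.
  move=> bT cT ->; exists (block_mx a b c (- a^T)); first exact/sp_block.
  by rewrite /rho howe_rho_rpair.
have dT (j k : 'I_n) : (delta_mx j k : 'M[R]_n)^T = delta_mx k j by rewrite trmx_delta.
have sT (j k : 'I_n) : (- (delta_mx j k + delta_mx k j) : 'M[R]_n)^T
    = - (delta_mx j k + delta_mx k j) by rewrite linearN linearD /= !dT addrC.
move=> [k [a [G [hG ->]]]].
elim/big_ind: _ => [|B B' [M sM <-] [M' sM' <-]|i _].
- by exists 0; [exact: sp0 | exact: rho0].
- exists (1 *: M + M'); first exact: sp_linear.
  by rewrite rho_linear rmorph1 scale1r.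
suff [M sM <-] : exists2 M, sp M & rho M = G i.
  exists (a i *: M + 0); first exact: sp_linear sM sp0.
  by rewrite rho_linear rho0 addr0.
(* Preimages are read off [howe_rho_rpair]: the block a, transposed in the pairing, yields the first
   family, c the family in d_q d_q and b the one in q q. The sign in the mixed cases is that of
   [mpB2E] and [mpC2E]. *)
case: (hG i) => [j l|j|j l jl|j|j l jl].
- rewrite mpAE; apply: (blk (delta_mx l j) 0 0); rewrite ?trmx0 //.
  by rewrite !rpair0 !addr0 dT rpair_delta.
- rewrite mpBE; apply: (blk 0 0 (delta_mx j j)); rewrite ?trmx0 ?dT //.
  by rewrite !rpair0 add0r addr0 rpair_delta.
- rewrite mpB2E; apply: (blk 0 0 (- (delta_mx j l + delta_mx l j))); rewrite ?trmx0 ?sT //.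
  by rewrite !rpair0 add0r addr0 rpairN rpairD !rpair_delta.
- rewrite mpCE; apply: (blk 0 (delta_mx j j) 0); rewrite ?trmx0 ?dT //.
  by rewrite !rpair0 !add0r rpair_delta.
rewrite mpC2E; apply: (blk 0 (- (delta_mx j l + delta_mx l j)) 0); rewrite ?trmx0 ?sT //.
by rewrite !rpair0 !add0r rpairN rpairD !rpair_delta.
Qed.

Lemma rho_isomorphism : (0 < n)%N -> sp_mp_isomorphism (@rho R n).
Proof.
move=> n_gt0; split; last exact: rho_bracket.
  split; [exact: mp_rho | exact: rho_inj | exact: rho_surj].
by move=> a M N _ _; exact: rho_linear.
Qed.

End Surjectivity.

Theorem proposition3p1 (R : realType) (n : nat) (hn : (0 < n)%N) :
  [/\ [/\ forall c : 'I_(n + n) -> R[i],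
            \sum_l c l *: Zop l = 0 :> (polS R n -> polS R n) ->
            forall l, c l = 0,
          forall A W : polS R n -> polS R n,
            mp A -> spanZ W -> spanZ (comm A W)
        & exists rho : 'M[R]_(n + n) -> polS R n -> polS R n,
            sp_mp_isomorphism rho /\ Z_defining_rep rho],
      forall (l : 'I_(n + n)) (F : polS R n), KerDs F -> KerDs (Zop l F)
    & forall (h : nat) (l : 'I_(n + n)) (F : polS R n),
        Ms h F -> Ms h.+1 (Zop l F)].
Proof.
split; first split.
- exact: Zop_free.
- move=> A W /rho_surj[M sM <-] [c ->].
  (* The new coordinate vector is M c. *)
  exists (fun k => \sum_l c l * (M k l)%:C).
  have -> : comm (rho M) (\sum_l c l *: Zop l) =
      \sum_l c l *: comm (rho M) (Zop l).
    (* Additivity of the commutator in its second argument uses that rho(M) is linear, so the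
       identity is proved inside [lop]. *)
    rewrite /rho; have -> : \sum_l c l *: Zop l
        = lop_fun (\sum_l c l *: howe_Z 'i%C (cJ R n) (@Wop R n) (@lop_d_z R n) (@Uop R n) l).
      by rewrite lop_fun_sum; apply: eq_bigr => l _; rewrite ZopE.
    rewrite commE br_sumr lop_fun_sum; apply: eq_bigr => l _.
    by rewrite brZr ZopE commE.
  under eq_bigr do rewrite rho_defining // scaler_sumr.
  rewrite exchange_big; apply: eq_bigr => k _ /=; rewrite scaler_suml.
  by apply: eq_bigr => l _; rewrite scalerA.
- by exists (@rho R n); split; [exact: rho_isomorphism | exact: rho_defining].
- exact: Zop_KerDs.
move=> h l F [hF kF]; split; last exact: Zop_KerDs.
by rewrite ZopE; exact: hom_howe_Z.
Qed.
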